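(* Let $\delta\in\mathbb C$ with $|\delta|>1$. There exists a dense $G_\delta$-subset (i.e. a dense countable intersection of open sets) $\mathcal U$ of $\mathcal H_\delta(\mathbb C^2)$ such that the Julia set of every map $F\in\mathcal U$ is equal to $\mathbb C^2$.
   Context: $\mathcal H_\delta(\mathbb C^2)$ denotes the space of all entire Hénon maps with Jacobian determinant $\delta$, i.e. maps $F\colon\mathbb C^2\to\mathbb C^2$, $F(z,w)=(f(z)-\delta w,z)$ with $f\colon\mathbb C\to\mathbb C$ entire, equipped with the compact-open topology. View $\mathbb C^2\subset\mathbb P^2=\mathbb P^2(\mathbb C)$ via $(z,w)\mapsto[z:w:1]$. The Fatou set of $F$ is the set of points of $\mathbb C^2$ that have an open neighborhood $U\subset\mathbb C^2$ on which the family of iterates $(F^n)_{n\ge 0}$ is normal as a family of maps into $\mathbb P^2$, i.e. every sequence of iterates has a subsequence converging uniformly on compact subsets of $U$ to a holomorphic map $U\to\mathbb P^2$. The Julia set is the complement in $\mathbb C^2$ of the Fatou set. *)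

(* Defs.v *)
From HB Require Import structures.
From mathcomp Require Import all_boot all_order all_algebra complex.
From mathcomp Require Import ring.
From mathcomp Require Import all_classical all_reals all_analysis.
Set Implicit Arguments.
Unset Strict Implicit.
Unset Printing Implicit Defensive.
Import Order.TTheory GRing.Theory Num.Theory.
Import numFieldNormedType.Exports.
Local Open Scope classical_set_scope.
Local Open Scope quotient_scope.
Local Open Scope ring_scope.

(* The field R[i] as a normed module over itself, so that [derivable] and
   [differentiable] below mean complex differentiability. *)
HB.instance Definition _ (R : rcfType) :=
  NormedModule.copy R[i] (R[i] : numClosedFieldType).

Section Chordal.
Variables (C : numClosedFieldType) (n : nat).
Implicit Types u v w : 'rV[C]_n.

(* Sine of the angle between the complex lines spanned by [u] and [v] (for
   nonzero [u] and [v]), with respect to the standard Hermitian product. *)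
Definition chordal u v : C :=
  sqrtC (1 - `|dotmx u v| ^+ 2 / (dotmx u u * dotmx v v)).

(* Orthogonal projection onto the line spanned by [u], flattened. *)
Let proj u : 'rV[C]_(n * n) :=
  mxvec (\matrix_(i, j) (u 0 i * (u 0 j)^* / dotmx u u)).

Let dotE m (u v : 'rV[C]_m) : dotmx u v = \sum_i u 0 i * (v 0 i)^*.
Proof. by rewrite dotmxE mxE; apply: eq_bigr => i _; rewrite !mxE. Qed.

Let dot_conj u : (dotmx u u)^* = dotmx u u.
Proof. by rewrite [RHS](hermC (@dotmx C n)) mul1r. Qed.

Let dot_proj u v :
  dotmx (proj u) (proj v) = `|dotmx u v| ^+ 2 / (dotmx u u * dotmx v v).
Proof.
rewrite dotE (reindex _ (curry_mxvec_bij _ _)) /=.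
rewrite (eq_bigr (fun ij : 'I_n * 'I_n => (u 0 ij.1 * (v 0 ij.1)^*) *
   ((u 0 ij.2)^* * v 0 ij.2) / (dotmx u u * dotmx v v))); last first.
  move=> [i j] _ /=; rewrite !mxvecE !mxE !rmorphM fmorphV /= conjCK dot_conj.
  by rewrite invfM; ring.
rewrite -mulr_suml; congr (_ / _).
rewrite -(pair_big xpredT xpredT (fun i j => u 0 i * (v 0 i)^* *
   ((u 0 j)^* * v 0 j))) /= -big_distrlr /= -dotE normCK; congr (_ * _).
rewrite dotE rmorph_sum; apply: eq_bigr => i _.
by rewrite rmorphM /= conjCK.
Qed.

Let chordalE u v : u != 0 -> v != 0 ->
  chordal u v = sqrtC (dotmx (proj u - proj v) (proj u - proj v) / 2).
Proof.
move=> u0 v0; rewrite /chordal; congr sqrtC.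
have nz w : w != 0 -> dotmx (proj w) (proj w) = 1.
  move=> w0; have dw : dotmx w w != 0 by rewrite (dnorm_eq0 (@dotmx C n)).
  rewrite dot_proj ger0_norm ?(dnorm_ge0 (@dotmx C n)) //.
  by rewrite -expr2 divff // expf_neq0.
have -> : dotmx (proj u - proj v) (proj u - proj v) =
    dotmx (proj u) (proj u) + dotmx (proj v) (proj v) -
    (dotmx (proj u) (proj v) + (dotmx (proj u) (proj v))^*).
  by have := hnormB (@dotmx C (n * n)) (proj u) (proj v); rewrite /= mul1r.
rewrite !nz // dot_proj conj_Creal.
  by set x := _ ^+ 2 / _; field.
by rewrite ger0_real ?divr_ge0 ?exprn_ge0 //; exact: mulr_ge0 (dnorm_ge0 (@dotmx C n) u) (dnorm_ge0 (@dotmx C n) v).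
Qed.

Lemma chordal_ge0 u v : u != 0 -> v != 0 -> 0 <= chordal u v.
Proof.
move=> u0 v0; rewrite chordalE // sqrtC_ge0 divr_ge0 //.
exact: (dnorm_ge0 (@dotmx C (n * n))).
Qed.

Lemma chordalC u v : chordal u v = chordal v u.
Proof.
rewrite /chordal [dotmx u u * _]mulrC.
by rewrite [dotmx u v](hermC (@dotmx C n)) mul1r norm_conjC.
Qed.

Lemma chordal_triangle v u w : u != 0 -> v != 0 -> w != 0 ->
  chordal u w <= chordal u v + chordal v w.
Proof.
move=> u0 v0 w0; rewrite !chordalE // !rootCMr ?invr_ge0 // -mulrDl.
rewrite ler_wpM2r ?rootC_ge0 ?invr_ge0 //.
have := (triangle_lerif (@dotmx C (n * n)) (proj u - proj v) (proj v - proj w)).1.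
by rewrite addrA subrK.
Qed.

Lemma chordal_eq0 u v : u != 0 -> v != 0 ->
  (chordal u v == 0) = (u == v)%MS.
Proof.
move=> u0 v0; rewrite /chordal sqrtC_eq0 subr_eq0 eq_sym.
have d0 w : w != 0 -> dotmx w w != 0 by rewrite (dnorm_eq0 (@dotmx C n)).
rewrite -[1](divff (mulf_neq0 (d0 _ u0) (d0 _ v0))).
rewrite (inj_eq (mulIf _)) ?invr_eq0 ?mulf_neq0 ?d0 //.
rewrite (CauchySchwarz (@dotmx C n) u v).2.
rewrite free_cons span_seq1 seq1_free v0 andbT negbK.
apply/vlineP/eqmxP => [[k uk]|/eqmxP/andP[/sub_rVP //]].
have k0 : k != 0 by apply: contra_neq u0 => k0; rewrite uk k0 scale0r.
by rewrite uk; exact: eqmx_scale.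
Qed.

Lemma chordalZ a b u v : a != 0 -> b != 0 ->
  chordal (a *: u) (b *: v) = chordal u v.
Proof.
move=> a0 b0; rewrite /chordal !dotE.
have dZ c d (x y : 'rV[C]_n) : dotmx (c *: x) (d *: y) = c * d^* * dotmx x y.
  rewrite !dotE mulr_sumr; apply: eq_bigr => i _.
  by rewrite !mxE rmorphM; ring.
rewrite -!dotE !dZ !normrM !exprMn norm_conjC !normCK.
have [->|u0] := eqVneq (dotmx u u) 0; first by rewrite !(mulr0, mul0r, invr0).
have [->|v0] := eqVneq (dotmx v v) 0; first by rewrite !(mulr0, mul0r, invr0).
by congr (sqrtC (1 - _)); field; rewrite ?conjC_eq0 ?a0 ?b0 ?u0 ?v0.
Qed.
End Chordal.

Section ProjectivePlane.
Variable R : realType.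
Local Notation C := R[i].

Definition nzvec : Type := {v : 'rV[C]_3 | v != 0}.
HB.instance Definition _ := Choice.on nzvec.

(* Equality of row spaces, i.e. of the spanned lines. *)
Definition same_line (u v : nzvec) : bool := (val u == val v)%MS.

Lemma same_line_equiv : equiv_class_of same_line.
Proof.
split=> [u|u v|v u w].
- exact/eqmxP.
- by rewrite /same_line andbC.
- by move=> /eqmxP uv /eqmxP vw; apply/eqmxP; exact: eqmx_trans uv vw.
Qed.

Canonical same_line_rel := EquivRelPack same_line_equiv.

Definition P2 : Type := {eq_quot same_line_rel}.
HB.instance Definition _ := Choice.on P2.
HB.instance Definition _ := Quotient.on P2.

Lemma P2_piE (u v : nzvec) : (\pi_P2 u == \pi_P2 v) = same_line u v.
Proof. exact: (eqmodE same_line_rel). Qed.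

(* Some choice of homogeneous coordinates. *)
Definition hcoords (p : P2) : 'rV[C]_3 := val (repr p).

(* The chordal metric. It induces the quotient topology of P^2; as P^2 is compact,
   uniform convergence is the same for every metric inducing that topology. *)
Definition P2_dist (p q : P2) : C := chordal (hcoords p) (hcoords q).

Lemma P2_dist_pi (u v : nzvec) :
  P2_dist (\pi_P2 u) (\pi_P2 v) = chordal (val u) (val v).
Proof.
have repr_pi w : exists2 a, a != 0 & val (repr (\pi_P2 w)) = a *: val w.
  have : same_line (repr (\pi_P2 w)) w by rewrite -P2_piE reprK.
  move=> /andP[/sub_rVP[a e] _]; exists a => //.
  by apply: contra_neq (valP (repr (\pi_P2 w))) => a0; rewrite e a0 scale0r.
rewrite /P2_dist /hcoords; have [a a0 ->] := repr_pi u; have [b b0 ->] := repr_pi v.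
exact: chordalZ.
Qed.

Lemma hcoords_neq0 (p : P2) : hcoords p != 0.
Proof. exact: (valP (repr p)). Qed.

Let distxx p : P2_dist p p = 0.
Proof. by apply/eqP; rewrite chordal_eq0 ?hcoords_neq0 //; exact/eqmxP. Qed.

Let dist_eq p q : P2_dist p q = 0 -> p = q.
Proof.
move/eqP; rewrite chordal_eq0 ?hcoords_neq0 // => pq.
by apply/eqP; rewrite -[p]reprK -[q]reprK P2_piE.
Qed.

Let dist_sym p q : P2_dist p q = P2_dist q p.
Proof. exact: chordalC. Qed.

Let dist_triangle q p r : P2_dist p r <= P2_dist p q + P2_dist q r.
Proof. by apply: chordal_triangle; exact: hcoords_neq0. Qed.

HB.instance Definition _ :=
  isMetric.Build C P2 distxx dist_eq dist_sym dist_triangle.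

(* The quotient x_j / x_i of homogeneous coordinates; where x_i != 0 it does
   not depend on the representative. *)
Definition hratio (j i : 'I_3) (p : P2) : C :=
  hcoords p 0 j / hcoords p 0 i.

(* The domain {x_i != 0} of the i-th standard affine chart
   p |-> (hratio j i p)_(j != i). *)
Definition chart_dom (i : 'I_3) : set P2 := [set p | hcoords p 0 i != 0].

Definition affine_vec (p : C * C) : 'rV[C]_3 :=
  \row_(j < 3) [:: p.1; p.2; 1]`_j.

Lemma affine_vec_neq0 p : affine_vec p != 0.
Proof.
by apply/eqP => /rowP /(_ ord_max) /eqP; rewrite !mxE /= oner_eq0.
Qed.

(* The inclusion (z, w) |-> [z : w : 1]. *)
Definition affine (p : C * C) : P2 :=
  \pi_P2 (exist (fun v : 'rV[C]_3 => v != 0) _ (affine_vec_neq0 p)).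

(* Meant for open [U]: near each point, the map lands in a standard chart, and is
   complex differentiable when read in it. *)
Definition holomorphic_on (U : set (C * C)) (g : C * C -> P2) : Prop :=
  forall x, U x -> exists i,
    (\forall y \near x, chart_dom i (g y)) /\
    forall j, differentiable (hratio j i \o g) x.

End ProjectivePlane.

Section Dynamics.
Variable R : realType.
Local Notation C := R[i].

(* Each member of [G] and each limit is a total function of which only the
   restriction to [U] matters; [k] need be neither increasing nor injective. *)
Definition normal_on (U : set (C * C)) (G : nat -> C * C -> P2 R) : Prop :=
  forall k : nat -> nat, exists phi : nat -> nat,
    {homo phi : m n / (m < n)%N} /\
    exists2 g : C * C -> P2 R, holomorphic_on U g &
      {family compactly_in U, (fun n => G (k (phi n))) @ \oo --> g}.

Definition fatou (F : C * C -> C * C) : set (C * C) :=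
  [set p | exists U : set (C * C),
    [/\ open U, U p & normal_on U (fun n => @affine R \o iter n F)]].

Definition julia (F : C * C -> C * C) : set (C * C) := ~` fatou F.

Definition entire (f : C -> C) : Prop := forall z, derivable f z 1.

(* As a type, [henon delta] carries the topology induced by the compact-open
   topology. *)
Definition henon (delta : C) : set {compact-open, (C * C)%type -> (C * C)%type} :=
  [set F | exists2 f : C -> C, entire f &
    F = fun p => (f p.1 - delta * p.2, p.1)].

End Dynamics.

(* Main.v *)
(** The spread condition for a ball B asks for two points of B that some iterate
    separates: one lands away from [1 : 0 : 0] in the projective plane, the other
    close to it. It is open in F, and if it holds for arbitrarily small balls
    around c then the iterates are not equicontinuous at c, so that c lies in the
    Julia set; the closed Julia set is everything once this holds for all rational c.

    For density, let F be given by f. Since |delta| > 1, some point of B has an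
    orbit (z_n) with |z_n| > rho: otherwise the iterates would be bounded on B, and
    so would their derivatives at the center (Cauchy's estimate), whereas their
    Jacobian determinants delta^n tend to infinity. At the first such n one puts
    x = z_n and adds A (z / x)^N to f with N large: this is tiny on |z| <= rho, it
    prescribes the next image of (x, z_(n-1)), and it makes the next image of
    (y, z_(n-1)) huge when |y| > |x|. The backward orbits of both points hardly
    change, hence still end in B.

    Cauchy's estimate for a merely differentiable function comes from Goursat's
    bisection argument, applied to u(s) = (f(exp s) - f(0)) / exp s on rectangles
    of height 2 pi: by periodicity the mean of (f(z) - f(0)) / z over a circle
    about 0 does not depend on the radius. *)

Require Import Defs.
From HB Require Import structures.
From mathcomp Require Import all_boot all_order all_algebra complex.
From mathcomp Require Import all_classical all_reals all_analysis borel_hierarchy.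
From mathcomp Require Import ring lra.
Set Implicit Arguments.
Unset Strict Implicit.
Unset Printing Implicit Defensive.
Import Order.TTheory GRing.Theory Num.Theory.
Import numFieldNormedType.Exports.
Local Open Scope classical_set_scope.
Local Open Scope ring_scope.
Local Open Scope complex_scope.
Local Notation Re := (@complex.Re _).
Local Notation Im := (@complex.Im _).

(** * Complex moduli and derivatives *)

Section FirstOrder.
Variable K : numFieldType.
Implicit Types (f : K -> K) (x d : K).

Lemma derivable_first_order f x : derivable f x 1 ->
  forall e : K, 0 < e -> exists2 r : K, 0 < r &
    forall h, `|h| < r -> `|f (x + h) - f x - 'D_1 f x * h| <= e * `|h|.
Proof.
rewrite /derivable -[X in X -> _]/(cvg _) => /cvgrPdist_lt df e e0.
have := df e e0.
rewrite near_withinE => /nbhs_normP[r /= r0 H].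
exists r => // h hr; have [->|h0] := eqVneq h 0.
  by rewrite addr0 mulr0 !subrr normr0 mulr0.
have := H h; rewrite /ball_ /= sub0r normrN => /(_ hr h0).
rewrite -[lim _]/('D_1 f x) => /ltW.
rewrite -(ler_pM2r (_ : 0 < `|h|)) ?normr_gt0 //.
apply: le_trans; rewrite -normrM -normrN.
rewrite /GRing.scale /= mulr1 mulrBl.
rewrite [_^-1 * _ * _]mulrAC mulVf // mul1r opprB [h + x]addrC.
exact: lexx.
Qed.

Lemma first_order_derivable f x d :
  (forall e : K, 0 < e -> exists2 r : K, 0 < r &
    forall h, `|h| < r -> `|f (x + h) - f x - d * h| <= e * `|h|) ->
  derivable f x 1.
Proof.
move=> fd; apply/cvg_ex; exists d.
apply/cvgrPdist_le => e /fd[r r0 H].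
rewrite near_withinE; apply/nbhs_normP; exists r => // h.
rewrite /ball_ /= sub0r normrN => hr h0.
rewrite -(ler_pM2r (_ : 0 < `|h|)) ?normr_gt0 //.
apply: le_trans (H _ hr); rewrite -normrM -normrN.
rewrite /GRing.scale /= mulr1 mulrBl.
rewrite [_^-1 * _ * _]mulrAC mulVf // mul1r opprB [h + x]addrC.
exact: lexx.
Qed.

End FirstOrder.

Section ComplexModulus.
Variable R : realType.
Implicit Types (x y : R) (z w : R[i]).

(** The norm of [R[i]] takes its values in [R[i]]; a modulus in [R] keeps all estimates in an
    ordered field within reach of [lra]. *)
Definition cabs z : R := Re `|z|.

Lemma cabsE z : (cabs z)%:C = `|z|.
Proof. by rewrite /cabs normc_def. Qed.

Lemma cabs_def z : cabs z = Num.sqrt (Re z ^+ 2 + Im z ^+ 2).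
Proof. by rewrite /cabs normc_def. Qed.

Lemma cabs_ge0 z : 0 <= cabs z.
Proof. by rewrite cabs_def sqrtr_ge0. Qed.

Lemma cabs0 : cabs 0 = 0.
Proof. by apply: (@complexI R); rewrite cabsE normr0. Qed.

Lemma cabs1 : cabs 1 = 1.
Proof. by apply: (@complexI R); rewrite cabsE normr1. Qed.

Lemma cabs_eq0 z : (cabs z == 0) = (z == 0).
Proof. by rewrite -(inj_eq (@complexI R)) cabsE normr_eq0. Qed.

Lemma cabs_gt0 z : (0 < cabs z) = (z != 0).
Proof. by rewrite lt0r cabs_ge0 andbT cabs_eq0. Qed.

Lemma cabsN z : cabs (- z) = cabs z.
Proof. by rewrite /cabs normrN. Qed.

Lemma cabsB z w : cabs (z - w) = cabs (w - z).
Proof. by rewrite -cabsN opprB. Qed.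

Lemma cabsM z w : cabs (z * w) = cabs z * cabs w.
Proof. by apply: (@complexI R); rewrite rmorphM /= !cabsE normrM. Qed.

Lemma cabsX z n : cabs (z ^+ n) = cabs z ^+ n.
Proof. by apply: (@complexI R); rewrite rmorphXn /= !cabsE normrX. Qed.

Lemma cabsV z : cabs z^-1 = (cabs z)^-1.
Proof. by apply: (@complexI R); rewrite fmorphV /= !cabsE normfV. Qed.

Lemma cabs_nat n : cabs n%:R = n%:R.
Proof. by apply: (@complexI R); rewrite rmorph_nat /= !cabsE normr_nat. Qed.

Lemma cabs_real x : cabs x%:C = `|x|.
Proof. by rewrite cabs_def /= expr0n addr0 sqrtr_sqr. Qed.

Lemma cabsD z w : cabs (z + w) <= cabs z + cabs w.
Proof. by rewrite -lecR rmorphD /= !cabsE ler_normD. Qed.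

Lemma cabs_triangle w z t : cabs (z - t) <= cabs (z - w) + cabs (w - t).
Proof. by apply: le_trans (cabsD _ _); rewrite addrA subrK. Qed.

Lemma cabs_sub_ge z w : cabs z - cabs w <= cabs (z - w).
Proof. by rewrite lerBlDr; apply: le_trans (cabsD _ _); rewrite subrK. Qed.

Lemma Re_le_cabs z : `|Re z| <= cabs z.
Proof.
by rewrite cabs_def -sqrtr_sqr ler_wsqrtr // lerDl sqr_ge0.
Qed.

Lemma Im_le_cabs z : `|Im z| <= cabs z.
Proof.
by rewrite cabs_def -sqrtr_sqr ler_wsqrtr // lerDr sqr_ge0.
Qed.

Lemma cabs_le_ReIm z : cabs z <= `|Re z| + `|Im z|.
Proof.
rewrite cabs_def -[leRHS]ger0_norm ?addr_ge0 // -sqrtr_sqr ler_wsqrtr //.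
rewrite sqrrD !real_normK ?num_real //.
have : 0 <= `|Re z| * `|Im z| by rewrite mulr_ge0.
by lra.
Qed.

(** Positive elements of [R[i]] are real, so radii may be taken in [R]. *)
Lemma nbhs_cabs z (A : set R[i]) :
  nbhs z A <-> exists2 e : R, 0 < e & forall w, cabs (w - z) < e -> A w.
Proof.
rewrite -nbhs_ballE; split=> [[e /= e0 eA]|[e e0 eA]].
  have er : (Re e)%:C = e by apply: RRe_real; exact: gtr0_real.
  exists (Re e); first by rewrite -ltcR er.
  by move=> w wz; apply: eA; rewrite -ball_normE /ball_ /= -er -cabsE ltcR cabsB.
exists e%:C => /=; first by rewrite ltcR.
by move=> w; rewrite -ball_normE /ball_ /= -cabsE ltcR cabsB => /eA.
Qed.

Lemma nbhs_cabs2 (p : R[i] * R[i]) (A : set (R[i] * R[i])) :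
  nbhs p A <-> exists2 e : R, 0 < e &
    forall q, cabs (q.1 - p.1) < e -> cabs (q.2 - p.2) < e -> A q.
Proof.
split=> [[[U V] /= [/nbhs_cabs[e e0 eU] /nbhs_cabs[d d0 dV]] UV]|[e e0 eA]].
  exists (Num.min e d); first by rewrite lt_min e0.
  move=> q; rewrite !lt_min => /andP[? _] /andP[_ ?].
  by apply: UV; split; [exact: eU|exact: dV].
exists ([set z | cabs (z - p.1) < e], [set z | cabs (z - p.2) < e]) => /=.
  by split; apply/nbhs_cabs; exists e.
by move=> [u v] /= [? ?]; exact: eA.
Qed.

(** The non-strict bound includes [h = 0] and avoids difference quotients. *)
Definition has_cderiv (f : R[i] -> R[i]) z (d : R[i]) : Prop :=
  forall e : R, 0 < e -> exists2 r : R, 0 < r &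
    forall h, cabs h < r -> cabs (f (z + h) - f z - d * h) <= e * cabs h.

Lemma derivable_has_cderiv (f : R[i] -> R[i]) z :
  derivable f z 1 -> has_cderiv f z ('D_1 f z).
Proof.
move=> /derivable_first_order df e e0.
have [|r r0 H] := df e%:C; first by rewrite ltcR.
have rr : (Re r)%:C = r by apply: RRe_real; exact: gtr0_real.
exists (Re r); first by rewrite -ltcR rr.
move=> h; rewrite -ltcR rr cabsE => /H.
by rewrite -!cabsE -rmorphM lecR.
Qed.

Lemma has_cderiv_derivable (f : R[i] -> R[i]) z d :
  has_cderiv f z d -> derivable f z 1.
Proof.
move=> fd; apply: (@first_order_derivable _ f z d) => e e0.
have er : (Re e)%:C = e by apply: RRe_real; exact: gtr0_real.
have := fd (Re e); rewrite -ltcR er => /(_ e0)[r r0 H].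
exists r%:C; first by rewrite ltcR.
move=> h; rewrite -cabsE ltcR => /H.
by rewrite -[X in _ -> _ <= X * _]er -!cabsE -rmorphM lecR.
Qed.

End ComplexModulus.

Lemma nested_segments (R : realType) (l r : nat -> R) : (forall k, l k <= l k.+1) ->
  (forall k, r k.+1 <= r k) -> (forall k, l k <= r k) ->
  exists s, forall k, l k <= s <= r k.
Proof.
move=> lS rS lr.
have lm m n : (m <= n)%N -> l m <= l n.
  elim: n => [|n IH]; rewrite leq_eqVlt => /orP[/eqP->//|//].
  by rewrite ltnS => /IH /le_trans; apply.
have rm m n : (m <= n)%N -> r n <= r m.
  elim: n => [|n IH]; rewrite leq_eqVlt => /orP[/eqP->//|//].
  by rewrite ltnS => /IH; apply: le_trans.
have ub k : ubound (range l) (r k).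
  move=> _ [n _ <-]; have [kn|/ltnW nk] := leqP k n.
    exact: le_trans (lr n) (rm _ _ kn).
  exact: le_trans (lm _ _ nk) (lr k).
exists (sup (range l)) => k; apply/andP; split.
  by apply: ub_le_sup; [exists (r 0%N); exact: ub|exists k].
by apply: ge_sup; [exists (l 0%N), 0%N|exact: ub].
Qed.

Lemma geometric_small (R : realType) (a x e : R) : `|x| < 1 -> 0 < e ->
  exists N, forall n, (N <= n)%N -> a * x ^+ n < e.
Proof.
move=> x1 e0; have /cvgrPdist_lt/(_ e e0)[N _ NP] := cvg_geometric a x1.
exists N => n /NP; rewrite sub0r normrN; apply: le_lt_trans.
exact: ler_norm.
Qed.

Section ComplexDerivative.
Variable R : realType.
Implicit Types (f g : R[i] -> R[i]) (z d a b : R[i]).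

Lemma has_cderiv_cont f z d : has_cderiv f z d ->
  forall e : R, 0 < e -> exists2 r : R, 0 < r &
    forall h, cabs h < r -> cabs (f (z + h) - f z) < e.
Proof.
move=> fd e e0; have [r r0 H] := fd 1 ltr01.
have d1 : 0 < cabs d + 1 by rewrite ltr_wpDl ?cabs_ge0.
exists (Num.min r (e / (cabs d + 1))); first by rewrite lt_min r0 divr_gt0.
move=> h; rewrite lt_min => /andP[/H hr]; rewrite ltr_pdivlMr // => he.
have := cabsD (f (z + h) - f z - d * h) (d * h); rewrite subrK cabsM.
by move: hr he; lra.
Qed.

Lemma has_cderiv_near f g z d : (exists2 r : R, 0 < r &
    forall h, cabs h < r -> f (z + h) = g (z + h)) ->
  has_cderiv f z d -> has_cderiv g z d.
Proof.
move=> [r r0 fg] fd e e0; have [s s0 H] := fd e e0.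
exists (Num.min r s); first by rewrite lt_min r0.
move=> h; rewrite lt_min => /andP[hr hs].
have := fg 0; rewrite cabs0 addr0 => /(_ r0) <-.
by rewrite -fg //; exact: H.
Qed.

Lemma has_cderiv_cst a z : has_cderiv (fun=> a) z 0.
Proof.
move=> e e0; exists 1 => // h _.
by rewrite subrr mul0r subr0 cabs0 mulr_ge0 ?cabs_ge0 ?ltW.
Qed.

Lemma has_cderiv_affine a b z : has_cderiv (fun t => a + b * t) z b.
Proof.
move=> e e0; exists 1 => // h _.
have -> : a + b * (z + h) - (a + b * z) - b * h = 0 by ring.
by rewrite cabs0 mulr_ge0 ?cabs_ge0 ?ltW.
Qed.

Lemma has_cderivD f g z a b : has_cderiv f z a -> has_cderiv g z b ->
  has_cderiv (fun t => f t + g t) z (a + b).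
Proof.
move=> fa gb e e0; have e2 : 0 < e / 2 by rewrite divr_gt0.
have [r r0 H] := fa _ e2; have [s s0 K] := gb _ e2.
exists (Num.min r s); first by rewrite lt_min r0.
move=> h; rewrite lt_min => /andP[/H hr /K hs].
have -> : f (z + h) + g (z + h) - (f z + g z) - (a + b) * h =
  (f (z + h) - f z - a * h) + (g (z + h) - g z - b * h) by ring.
by apply: le_trans (cabsD _ _) _; move: hr hs; lra.
Qed.

Lemma has_cderiv_comp f g z a b : has_cderiv f z a -> has_cderiv g (f z) b ->
  has_cderiv (g \o f) z (b * a).
Proof.
move=> fa gb e e0.
have a1 : 0 < cabs a + 1 by rewrite ltr_wpDl ?cabs_ge0.
have b1 : 0 < cabs b + 1 by rewrite ltr_wpDl ?cabs_ge0.
pose e1 := e / (2 * (cabs a + 1)); pose e2 := Num.min 1 (e / (2 * (cabs b + 1))).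
have e10 : 0 < e1 by rewrite divr_gt0 // mulr_gt0.
have e20 : 0 < e2 by rewrite lt_min ltr01 divr_gt0 // mulr_gt0.
have [s s0 K] := gb _ e10; have [r r0 H] := fa _ e20.
have [t t0 L] := has_cderiv_cont fa s0.
exists (Num.min r t); first by rewrite lt_min r0.
move=> h; rewrite lt_min => /andP[/H hr /L /K]; set k := f (z + h) - f z.
rewrite (_ : f z + k = f (z + h)) /= => [hk|]; last by rewrite /k addrC subrK.
have -> : g (f (z + h)) - g (f z) - b * a * h =
  (g (f (z + h)) - g (f z) - b * k) + b * (k - a * h) by ring.
apply: le_trans (cabsD _ _) _; rewrite cabsM.
have h0 := cabs_ge0 h; have bge := cabs_ge0 b.
have kh : cabs k <= (cabs a + 1) * cabs h.
  rewrite -[k](subrK (a * h)); apply: le_trans (cabsD _ _) _; rewrite cabsM.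
  have : e2 * cabs h <= 1 * cabs h by rewrite ler_wpM2r // ge_min lexx.
  by move: hr; rewrite -/k; lra.
have E1 : e1 * cabs k <= e / 2 * cabs h.
  apply: le_trans (ler_wpM2l (ltW e10) kh) _.
  by rewrite mulrA /e1 invfM mulrA mulfVK ?gt_eqF.
have E2 : cabs b * cabs (k - a * h) <= e / 2 * cabs h.
  apply: le_trans (ler_wpM2l bge hr) _; rewrite mulrA ler_wpM2r //.
  have : cabs b * e2 <= (cabs b + 1) * (e / (2 * (cabs b + 1))).
    rewrite ler_pM // ?(ltW e20) ?lerDl //.
    by rewrite /e2 ge_min lexx orbT.
  suff -> : (cabs b + 1) * (e / (2 * (cabs b + 1))) = e / 2 by [].
  by field; rewrite gt_eqF.
by move: hk E1 E2; lra.
Qed.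

Lemma entire_has_cderiv f : entire f -> forall z, exists d, has_cderiv f z d.
Proof. by move=> ef z; exists ('D_1 f z); exact: derivable_has_cderiv. Qed.

End ComplexDerivative.

(** * The complex exponential and primitives *)

Section ComplexExponential.
Variable R : realType.
Implicit Types z w : R[i].

Definition cexp z : R[i] :=
  (expR (Re z) * cos (Im z)) +i* (expR (Re z) * sin (Im z)).

Lemma cexpD z w : cexp (z + w) = cexp z * cexp w.
Proof.
case: z => x y; case: w => a b; rewrite /cexp /= expRD sinD cosD.
by apply/eqP; rewrite eq_complex /=; apply/andP; split; apply/eqP; ring.
Qed.

Lemma cexp_2pi z : cexp (z + (pi *+ 2)*i) = cexp z.
Proof. by case: z => x y; rewrite /cexp /= addr0 cosD2pi sinD2pi. Qed.

Lemma cabs_cexp z : cabs (cexp z) = expR (Re z).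
Proof.
by rewrite cabs_def /= !exprMn -mulrDr cos2Dsin2 mulr1 sqrtr_sqr ger0_norm ?expR_ge0.

Qed.

Lemma cexp_neq0 z : cexp z != 0.
Proof. by rewrite -cabs_gt0 cabs_cexp expR_gt0. Qed.

Let real_first_order (f : R -> R) (d e : R) : is_derive (0 : R) (1 : R) f d -> 0 < e ->
  exists2 r, 0 < r & forall h, `|h| < r -> `|f h - f 0 - d * h| <= e * `|h|.
Proof.
move=> [df <-] /(derivable_first_order df)[r r0 H].
by exists r => // h /H; rewrite add0r.
Qed.

Lemma has_cderiv_cexp z : has_cderiv cexp z (cexp z).
Proof.
move=> e e0; set E := cabs (cexp z).
have E0 : 0 < E by rewrite cabs_gt0 cexp_neq0.
(* By the addition formula only the expansion at 0 matters. [k] is both the accuracy of the three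
   real expansions and a bound on [|h|]; the errors add up to at most [8 * (k * |h|)]. *)
have [k [k0 k1 ke]] : exists k, [/\ 0 < k, k <= 1 & k * (8 * E) <= e].
  exists (Num.min 1 (e / (8 * E))); split.
  - by rewrite lt_min ltr01 divr_gt0 // mulr_gt0.
  - by rewrite ge_min lexx.
  - by rewrite -ler_pdivlMr ?mulr_gt0 // ge_min lexx orbT.
have [r1 r10 H1] := real_first_order (is_derive_expR 0) k0.
have [r2 r20 H2] := real_first_order (is_derive_sin 0) k0.
have [r3 r30 H3] := real_first_order (is_derive_cos 0) k0.
exists (Num.min k (Num.min r1 (Num.min r2 r3))).
  by rewrite !lt_min k0 r10 r20 r30.
move=> h; rewrite !lt_min => /and4P[hk h1 h2 h3].
have -> : cexp (z + h) - cexp z - cexp z * h = cexp z * (cexp h - 1 - h).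
  by rewrite cexpD; ring.
rewrite cabsM -/E; have Rh := Re_le_cabs h; have Ih := Im_le_cabs h.
have {H1}:= H1 _ (le_lt_trans Rh h1); rewrite expR0 mul1r.
have {H2}:= H2 _ (le_lt_trans Ih h2); rewrite sin0 subr0 cos0 mul1r.
have {H3}:= H3 _ (le_lt_trans Ih h3); rewrite sin0 oppr0 mul0r subr0 cos0.
set x := Re h in Rh *; set y := Im h in Ih *; move=> Hc Hs He.
have hh := cabs_ge0 h.
have kx : k * `|x| <= k * cabs h by rewrite ler_wpM2l // ltW.
have ky : k * `|y| <= k * cabs h by rewrite ler_wpM2l // ltW.
have kh1 : k * cabs h <= cabs h by rewrite ler_piMl.
have kh2 : k * cabs h <= k * k by rewrite ler_wpM2l // ltW.
have kk : k * k <= k by rewrite ler_piMl // ltW.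
have ex1 : `|expR x - 1| <= 2 * k.
  rewrite -[expR x - 1](subrK x); apply: le_trans (ler_normD _ _) _.
  by lra.
have ex3 : `|expR x| <= 3.
  rewrite -[expR x](subrK 1); apply: le_trans (ler_normD _ _) _.
  by rewrite normr1; lra.
suff H : cabs (cexp h - 1 - h) <= 8 * (k * cabs h).
  apply: le_trans (ler_wpM2l (ltW E0) H) _.
  have -> : E * (8 * (k * cabs h)) = k * (8 * E) * cabs h by ring.
  by rewrite ler_wpM2r.
apply: le_trans (cabs_le_ReIm _) _.
have -> : Re (cexp h - 1 - h) =
    (expR x - 1 - x) * cos y + (1 + x) * (cos y - 1).
  by rewrite /cexp /x /y; case: (h) => a b /=; ring.
have -> : Im (cexp h - 1 - h) = expR x * (sin y - y) + (expR x - 1) * y.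
  by rewrite /cexp /x /y; case: (h) => a b /=; ring.
have A1 : `|(expR x - 1 - x) * cos y| <= k * cabs h.
  rewrite normrM; apply: le_trans (ler_wpM2l (normr_ge0 _) (cos_max _)) _.
  by rewrite mulr1; lra.
have A2 : `|(1 + x) * (cos y - 1)| <= 2 * (k * cabs h).
  rewrite normrM ler_pM //; last by lra.
  by apply: le_trans (ler_normD _ _) _; rewrite normr1; lra.
have A3 : `|expR x * (sin y - y)| <= 3 * (k * cabs h).
  by rewrite normrM ler_pM //; lra.
have A4 : `|(expR x - 1) * y| <= 2 * (k * cabs h).
  rewrite normrM mulrA; apply: ler_pM => //; lra.
apply: le_trans (lerD (ler_normD _ _) (ler_normD _ _)) _.
by lra.
Qed.

End ComplexExponential.

Section Primitive.
Variable R : realType.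
Implicit Types (A a b K : R).

Lemma continuous_primitive (f : R -> R) A : continuous f ->
  exists F : R -> R, forall x, A < x -> is_derive x 1 F (f x).
Proof.
move=> cf; pose F x := (\int[@lebesgue_measure R]_(t in `[A, x]) f t)%R.
(* The interval of integration reaches beyond [x], which is thus an interior point. *)
exists F => x Ax; have x1 : x < x + 1 by rewrite ltrDl.
have fi : (@lebesgue_measure R).-integrable `[A, x + 1] (EFin \o f).
  apply: continuous_compact_integrable; first exact: segment_compact.
  exact: continuous_subspaceT.
have [dF dFE] := continuous_FTC1_closed x1 fi Ax (cf x).
by split=> //; rewrite -derive1E.
Qed.

Lemma mvt_estimate (F G f g : R -> R) a b K : a <= b ->
  (forall x, a <= x <= b -> is_derive x 1 F (f x)) ->
  (forall x, a <= x <= b -> is_derive x 1 G (g x)) ->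
  (forall x, a <= x <= b -> `|f x - g x| <= K) ->
  `|(F b - F a) - (G b - G a)| <= K * (b - a).
Proof.
move=> ab dF dG fgK.
have dFG x : a <= x <= b -> is_derive x 1 (F \- G) (f x - g x).
  by move=> xab; apply: is_deriveB; [exact: dF|exact: dG].
have [||c] := @MVT_segment R (F \- G) (fun x => f x - g x) a b ab.
- by move=> x; rewrite in_itv /= => /andP[/ltW ? /ltW ?]; apply: dFG; apply/andP.
- apply: derivable_within_continuous => x; rewrite in_itv /= => /dFG.
  by case.
rewrite in_itv /= => /fgK cK /= E.
have -> : F b - F a - (G b - G a) = (f c - g c) * (b - a) by rewrite -E; ring.
by rewrite normrM [`|b - a|]ger0_norm ?subr_ge0 // ler_wpM2r ?subr_ge0.
Qed.

(** Primitives come as integrals from the base point [A], hence are differentiated only to its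
    right; splitting into real and imaginary parts gives access to real calculus. *)
Definition is_primitive A (P f : R -> R[i]) := forall x, A < x ->
  is_derive x 1 (Re \o P) (Re (f x)) /\ is_derive x 1 (Im \o P) (Im (f x)).

(** A choice depending on the integrand alone, so that equal integrands have equal primitives. Only
    differences of its values are used, which are the integrals. *)
Definition primitive A (f : R -> R[i]) : R -> R[i] :=
  xget (fun=> 0) [set P | is_primitive A P f].

Lemma primitiveP A f : continuous (Re \o f) -> continuous (Im \o f) ->
  is_primitive A (primitive A f) f.
Proof.
move=> /(continuous_primitive A)[P dP] /(continuous_primitive A)[Q dQ].
rewrite /primitive; case: xgetP => [F _ //|/(_ (fun x => P x +i* Q x))[]] x Ax.
by split; [exact: dP|exact: dQ].
Qed.

(** The mean value theorem is applied to real and imaginary parts separately, whence the factor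
    2. *)
Lemma primitive_estimate A (F G f g : R -> R[i]) a b K : A < a -> a <= b ->
  is_primitive A F f -> is_primitive A G g ->
  (forall x, a <= x <= b -> cabs (f x - g x) <= K) ->
  cabs ((F b - F a) - (G b - G a)) <= 2 * K * (b - a).
Proof.
move=> Aa ab dF dG fgK; apply: le_trans (cabs_le_ReIm _) _.
rewrite -mulrA mulr2n mulrDl mul1r.
have Aab x : a <= x <= b -> A < x by move=> /andP[ax _]; exact: lt_le_trans ax.
have ReB (u v : R[i]) : Re (u - v) = Re u - Re v by case: u; case: v.
have ImB (u v : R[i]) : Im (u - v) = Im u - Im v by case: u; case: v.
rewrite !ReB !ImB; apply: lerD.
  apply: (@mvt_estimate (Re \o F) (Re \o G) (Re \o f) (Re \o g)) => // x xab.
  - by case: (dF x (Aab x xab)).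
  - by case: (dG x (Aab x xab)).
  - by rewrite /= -ReB; apply: le_trans (Re_le_cabs _) (fgK _ xab).
apply: (@mvt_estimate (Im \o F) (Im \o G) (Im \o f) (Im \o g)) => // x xab.
- by case: (dF x (Aab x xab)).
- by case: (dG x (Aab x xab)).
- by rewrite /= -ImB; apply: le_trans (Im_le_cabs _) (fgK _ xab).
Qed.

Lemma is_primitive_affine A (c d : R[i]) :
  is_primitive A (fun x => c * x%:C + d * x%:C ^+ 2 / 2)
    (fun x => c + d * x%:C).
Proof.
have two : (2 : R[i])^-1 = (2^-1)%:C by rewrite fmorphV rmorph_nat.
have ReE x : Re (c + d * x%:C) = Re c + Re d * x.
  by clear; case: c; case: d => * /=; ring.
have ImE x : Im (c + d * x%:C) = Im c + Im d * x.
  by clear; case: c; case: d => * /=; ring.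
have RePE : Re \o (fun x => c * x%:C + d * x%:C ^+ 2 / 2) =
    (fun x => Re c * x + (Re d / 2) * x ^+ 2).
  apply/funext => t; rewrite two /=; clear.
  by case: c; case: d => * /=; ring.
have ImPE : Im \o (fun x => c * x%:C + d * x%:C ^+ 2 / 2) =
    (fun x => Im c * x + (Im d / 2) * x ^+ 2).
  apply/funext => t; rewrite two /=; clear.
  by case: c; case: d => * /=; ring.
move=> x _; rewrite ReE ImE RePE ImPE.
by split; apply: is_derive_eq; rewrite /GRing.scale /=; field.
Qed.

End Primitive.

(** * Goursat's theorem and Cauchy's estimate *)

Section Goursat.
Variables (R : realType) (u : R[i] -> R[i]) (A : R).
Hypothesis du : forall z, exists d, has_cderiv u z d.
Implicit Types (s t a b K e : R).

Let line_cont z v : continuous (fun t => Re (u (z + v * t%:C))) /\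
  continuous (fun t => Im (u (z + v * t%:C))).
Proof.
have H t e : 0 < e -> exists2 r : R, 0 < r & forall x, `|t - x| < r ->
    cabs (u (z + v * t%:C) - u (z + v * x%:C)) < e.
  move=> e0; have [d ud] := du (z + v * t%:C).
  have [r r0 H] := has_cderiv_cont ud e0.
  have v1 : 0 < cabs v + 1 by rewrite ltr_wpDl ?cabs_ge0.
  exists (r / (cabs v + 1)); first by rewrite divr_gt0.
  move=> x; rewrite ltr_pdivlMr // => xr; rewrite cabsB.
  have := H (v * (x - t)%:C).
  have -> : z + v * t%:C + v * (x - t)%:C = z + v * x%:C.
    by rewrite rmorphB /=; ring.
  apply; rewrite cabsM cabs_real distrC mulrC.
  by apply: le_lt_trans xr; rewrite ler_wpM2l // lerDl.
have ReB (x y : R[i]) : Re x - Re y = Re (x - y) by case: x; case: y.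
have ImB (x y : R[i]) : Im x - Im y = Im (x - y) by case: x; case: y.
split=> t; apply/cvgrPdist_lt => e /(H t)[r r0 {}H];
  apply/nbhs_ballP; exists r => //= x xr.
  by rewrite ReB; apply: le_lt_trans (Re_le_cabs _) (H _ xr).
by rewrite ImB; apply: le_lt_trans (Im_le_cabs _) (H _ xr).
Qed.

(** The factor [1 *] gives both lines the shape [z + v * t] of [line_cont]. Both primitives are in
    the real parameter, so the factor ['i] of dz on vertical sides is left to [rect_int]. *)
Definition hline t : R -> R[i] := primitive A (fun s => u (t*i + 1 * s%:C)).
Definition vline s : R -> R[i] := primitive A (fun t => u (s%:C + 'i * t%:C)).

Lemma hlineP t : is_primitive A (hline t) (fun s => u (t*i + 1 * s%:C)).
Proof. by apply: primitiveP; have [] := line_cont (t*i) 1. Qed.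

Lemma vlineP s : is_primitive A (vline s) (fun t => u (s%:C + 'i * t%:C)).
Proof. by apply: primitiveP; have [] := line_cont s%:C 'i. Qed.

(* The integral of u along the boundary of the rectangle [a, a'] x [b, b']. *)
Definition rect_int (a a' b b' : R) : R[i] :=
  (hline b a' - hline b a) + 'i * (vline a' b' - vline a' b)
  - (hline b' a' - hline b' a) - 'i * (vline a b' - vline a b).

(** The boundary integral of an affine function vanishes, as its explicit quadratic primitives [q]
    show. What is left on each side is at most [2 * e] times its length. *)
Lemma rect_int_small a a' b b' c d e :
  A < a -> a <= a' -> A < b -> b <= b' ->
  (forall s t, a <= s <= a' -> b <= t <= b' ->
    cabs (u (s +i* t) - (c + d * (s +i* t))) <= e) ->
  cabs (rect_int a a' b b') <= 4 * e * ((a' - a) + (b' - b)).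
Proof.
move=> Aa aa' Ab bb' ue.
have st (s t : R) : (s +i* t) = s%:C + 'i * t%:C :> R[i] by exact: (complexE (s +i* t)).
pose q (v w : R[i]) (x : R) := v * x%:C + w * x%:C ^+ 2 / 2.
have Hh t : b <= t <= b' -> cabs ((hline t a' - hline t a) -
    (q (c + d * ('i * t%:C)) d a' - q (c + d * ('i * t%:C)) d a))
    <= 2 * e * (a' - a).
  move=> tb; apply: (@primitive_estimate _ _ _ _ _ _ _ _ _ Aa aa' (hlineP t)
    (@is_primitive_affine _ A (c + d * ('i * t%:C)) d)) => s sa /=.
  have := ue s t sa tb; rewrite st.
  have -> : t*i + 1 * s%:C = s%:C + 'i * t%:C :> R[i].
    by rewrite -st; apply/eqP; rewrite eq_complex /=; apply/andP; split;
      apply/eqP; ring.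
  by congr (cabs _ <= _); ring.
have Hv s : a <= s <= a' -> cabs ((vline s b' - vline s b) -
    (q (c + d * s%:C) (d * 'i) b' - q (c + d * s%:C) (d * 'i) b))
    <= 2 * e * (b' - b).
  move=> sa; apply: (@primitive_estimate _ _ _ _ _ _ _ _ _ Ab bb' (vlineP s)
    (@is_primitive_affine _ A (c + d * s%:C) (d * 'i))) => t tb /=.
  have := ue s t sa tb; rewrite st.
  by congr (cabs _ <= _); ring.
have ci : cabs 'i = 1 :> R by rewrite cabs_def /= expr0n expr1n add0r sqrtr1.
have := Hh b; rewrite lexx bb' => /(_ isT).
have := Hh b'; rewrite lexx bb' => /(_ isT).
have := Hv a; rewrite lexx aa' => /(_ isT).
have := Hv a'; rewrite lexx aa' => /(_ isT).
rewrite /rect_int.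
set h0 := hline b a' - hline b a; set h1 := hline b' a' - hline b' a.
set v0 := vline a b' - vline a b; set v1 := vline a' b' - vline a' b.
set p0 := q _ _ b' - q _ _ b; set p1 := q _ _ b' - q _ _ b.
set p2 := q _ _ a' - q _ _ a; set p3 := q _ _ a' - q _ _ a.
move=> H0 H1 H2 H3.
have -> : h0 + 'i * v1 - h1 - 'i * v0 =
   (h0 - p3) + 'i * (v1 - p0) - (h1 - p2) - 'i * (v0 - p1).
  by rewrite /p0 /p1 /p2 /p3 /q; ring.
apply: le_trans (cabsD _ _) _; rewrite cabsN cabsM ci mul1r.
apply: le_trans (lerD (cabsD _ _) (lexx _)) _; rewrite cabsN.
apply: le_trans (lerD (lerD (cabsD _ _) (lexx _)) (lexx _)) _.
by rewrite cabsM ci mul1r; move: H0 H1 H2 H3; lra.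
Qed.

Lemma rect_int_split a a' b b' m n :
  rect_int a a' b b' = rect_int a m b n + rect_int m a' b n
    + (rect_int a m n b' + rect_int m a' n b').
Proof. by rewrite /rect_int; ring. Qed.

Let I (q : (R * R) * (R * R)) := cabs (rect_int q.1.1 q.1.2 q.2.1 q.2.2).

Let halves (q q' : (R * R) * (R * R)) :=
  [/\ q.1.1 <= q'.1.1, q'.1.2 <= q.1.2 & q'.1.2 - q'.1.1 = (q.1.2 - q.1.1) / 2]
  /\ [/\ q.2.1 <= q'.2.1, q'.2.2 <= q.2.2 & q'.2.2 - q'.2.1 = (q.2.2 - q.2.1) / 2].

(** The integrals over the four quarters add up to the whole, so one of them has at least a quarter
    of its modulus. *)
Let bisect q : q.1.1 <= q.1.2 -> q.2.1 <= q.2.2 ->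
  exists q', halves q q' /\ I q <= 4 * I q'.
Proof.
case: q => [[a a'] [b b']] /= aa' bb'.
pose m := (a + a') / 2; pose n := (b + b') / 2.
have := rect_int_split a a' b b' m n => E.
have S : I ((a, a'), (b, b')) <= I ((a, m), (b, n)) + I ((m, a'), (b, n)) +
    (I ((a, m), (n, b')) + I ((m, a'), (n, b'))).
  rewrite /I /= E; apply: le_trans (cabsD _ _) _.
  exact: lerD (cabsD _ _) (cabsD _ _).
have am : a <= m by rewrite /m; lra.
have ma : m <= a' by rewrite /m; lra.
have bn : b <= n by rewrite /n; lra.
have nb : n <= b' by rewrite /n; lra.
have [H|H1] := leP (I ((a, a'), (b, b'))) (4 * I ((a, m), (b, n))).
  by exists ((a, m), (b, n)); split => //; split; split => //=; rewrite /m /n; lra.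
have [H|H2] := leP (I ((a, a'), (b, b'))) (4 * I ((m, a'), (b, n))).
  by exists ((m, a'), (b, n)); split => //; split; split => //=; rewrite /m /n; lra.
have [H|H3] := leP (I ((a, a'), (b, b'))) (4 * I ((a, m), (n, b'))).
  by exists ((a, m), (n, b')); split => //; split; split => //=; rewrite /m /n; lra.
exists ((m, a'), (n, b')); split; last by lra.
by split; split => //=; rewrite /m /n; lra.
Qed.

(** Bisection closes in on a point where [u] is affine up to o(diameter). The k-th integral is
    therefore o(4^-k), yet at least 4^-k times the original one. *)
Theorem goursat a a' b b' : A < a -> a <= a' -> A < b -> b <= b' ->
  rect_int a a' b b' = 0.
Proof.
move=> Aa aa' Ab bb'; apply/eqP; rewrite -cabs_eq0 -[cabs _]/(I ((a, a'), (b, b'))).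
(* The order conditions stand behind the existential so that [choice] gives a map on all quadruples;
   [q] itself is the default for disordered ones. *)
have /choice[N NP] : forall q, exists q', q.1.1 <= q.1.2 -> q.2.1 <= q.2.2 ->
    halves q q' /\ I q <= 4 * I q'.
  move=> q; have [q1|q1] := leP q.1.1 q.1.2; last by exists q; lra.
  have [q2|q2] := leP q.2.1 q.2.2; last by exists q => _; lra.
  by have [q' ?] := bisect q1 q2; exists q'.
set q0 := ((a, a'), (b, b')); pose q k := iter k N q0.
have qP k : [/\ (q k).1.2 - (q k).1.1 = (a' - a) / 2 ^+ k,
    (q k).2.2 - (q k).2.1 = (b' - b) / 2 ^+ k & I q0 <= 4 ^+ k * I (q k)].
  elim: k => [|k [IH1 IH2 IH3]].
    by rewrite !expr0 /= !divr1 mul1r.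
  have k2 : (0 : R) <= 2 ^- k by rewrite invr_ge0 exprn_ge0.
  have [||] := NP (q k).
  - by rewrite -subr_ge0 IH1 mulr_ge0 // subr_ge0.
  - by rewrite -subr_ge0 IH2 mulr_ge0 // subr_ge0.
  rewrite -/(q k.+1) => -[[_ _ ->] [_ _ ->]] IqN.
  rewrite IH1 IH2 !exprSr !invfM !mulrA; split => //.
  apply: le_trans IH3 _; by rewrite -mulrA ler_wpM2l ?exprn_ge0.
have q12 k : (q k).1.1 <= (q k).1.2 /\ (q k).2.1 <= (q k).2.2.
  have [E1 E2 _] := qP k; rewrite -!(subr_ge0 (_.1)) E1 E2.
  by split; rewrite mulr_ge0 ?invr_ge0 ?exprn_ge0 ?subr_ge0.
have qh k : halves (q k) (q k.+1).
  by have [q1 q2] := q12 k; have [] := NP (q k) q1 q2.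
have [s sP] : exists s, forall k, (q k).1.1 <= s <= (q k).1.2.
  apply: nested_segments => k; last by have [] := q12 k.
  - by have [[]] := qh k.
  - by have [[]] := qh k.
have [t tP] : exists t, forall k, (q k).2.1 <= t <= (q k).2.2.
  apply: nested_segments => k; last by have [] := q12 k.
  - by have [_ []] := qh k.
  - by have [_ []] := qh k.
have qA k : A < (q k).1.1 /\ A < (q k).2.1.
  elim: k => [//|k [IH1 IH2]]; have [[H1 _ _] [H2 _ _]] := qh k.
  by split; [apply: lt_le_trans H1|apply: lt_le_trans H2].
rewrite eq_le cabs_ge0 andbT; apply/ler_addgt0Pr => e e0; rewrite add0r.
set W := (a' - a) + (b' - b).
have W0 : 0 <= W by rewrite addr_ge0 ?subr_ge0.
have W1 : 0 < 4 * W ^+ 2 + 1 by rewrite ltr_wpDl // mulr_ge0 // sqr_ge0.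
(* [W / 2 ^+ k] is the half-perimeter of the k-th rectangle and bounds its diameter, so 4^k times
   its integral is at most [4 * e1 * W ^+ 2 <= e]; the [+ 1] covers [W = 0]. *)
pose e1 := e / (4 * W ^+ 2 + 1).
have e10 : 0 < e1 by rewrite divr_gt0.
have [d] := du (s +i* t) => /(_ _ e10)[r r0 ud].
have [k kr] : exists k, W / 2 ^+ k < r.
  have [//|k] := @geometric_small _ W 2^-1 r _ r0; first by rewrite ger0_norm //; lra.
  by move=> /(_ k (leqnn k)); exists k; rewrite -exprVn.
have [E1 E2 E3] := qP k; have [q1 q2] := q12 k; have [A1 A2] := qA k.
have := @rect_int_small _ _ _ _ (u (s +i* t) - d * (s +i* t)) d
  (e1 * (W / 2 ^+ k)) A1 q1 A2 q2.
rewrite -[cabs (rect_int _ _ _ _)]/(I (q k)) E1 E2 -mulrDl -/W => H.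
apply: le_trans E3 _; apply: le_trans (ler_wpM2l _ (H _)) _.
- by rewrite exprn_ge0.
- move=> x y x1 y1; have s1 := sP k; have t1 := tP k.
  have xyW : cabs ((x +i* y) - (s +i* t)) <= W / 2 ^+ k.
    apply: le_trans (cabs_le_ReIm _) _; rewrite /= /W mulrDl -E1 -E2.
    by apply: lerD; rewrite ler_norml; lra.
  have := ud _ (le_lt_trans xyW kr); rewrite subrKC => H1.
  have -> : u (x +i* y) - (u (s +i* t) - d * (s +i* t) + d * (x +i* y)) =
    u (x +i* y) - u (s +i* t) - d * ((x +i* y) - (s +i* t)) by ring.
  by apply: le_trans H1 _; rewrite ler_wpM2l // ltW.
have -> : 4 ^+ k * (4 * (e1 * (W / 2 ^+ k)) * (W / 2 ^+ k)) =
    e1 * (4 * W ^+ 2) * (4 ^+ k / (2 ^+ k * 2 ^+ k)) by field; rewrite expf_neq0.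
rewrite -exprMn (_ : 2 * 2 = 4 :> R) -?natrM // mulfV ?expf_neq0 // mulr1.
by rewrite mulrAC ler_pdivrMr // ler_pM2l // lerDl.
Qed.

End Goursat.

Section CauchyEstimate.
Variable R : realType.

Lemma has_cderivM (f g : R[i] -> R[i]) z a b : has_cderiv f z a ->
  has_cderiv g z b -> exists d, has_cderiv (fun t => f t * g t) z d.
Proof.
move=> /has_cderiv_derivable df /has_cderiv_derivable dg.
exists ('D_1 (f * g) z).
by have := derivable_has_cderiv (derivableM df dg).
Qed.

(** By periodicity the two horizontal sides cancel in Goursat's theorem, which leaves the vertical
    ones. *)
Lemma vline_periodic (u : R[i] -> R[i]) (P A s t : R) :
  (forall z, exists d, has_cderiv u z d) -> (forall z, u (z + P*i) = u z) ->
  0 <= P -> A < s -> s <= t -> A < 0 ->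
  vline u A t P - vline u A t 0 = vline u A s P - vline u A s 0.
Proof.
move=> du uP P0 As st A0; have := goursat du As st A0 P0; rewrite /rect_int.
have -> : hline u A P = hline u A 0.
  congr primitive; apply/funext => x; rewrite -[RHS]uP; congr u.
  by apply/eqP; rewrite eq_complex /=; apply/andP; split; apply/eqP; ring.
have E (x y v : R[i]) : x + y - x - v = y - v by ring.
rewrite E -mulrBr => /eqP.
rewrite mulf_eq0 subr_eq0 => /orP[|/eqP//].
by rewrite eq_complex /= oner_eq0 andbF.
Qed.

Lemma cauchy_estimate (f : R[i] -> R[i]) d (r M : R) :
  (forall z, exists d, has_cderiv f z d) -> has_cderiv f 0 d -> 0 < r ->
  (forall z, cabs z = r -> cabs (f z - f 0) <= M) -> cabs d <= 2 * (M / r).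
Proof.
move=> df fd r0 fM.
(* Multiplying by [cexp (- z)] instead of dividing lets the product and chain rules give the
   derivative. *)
pose u z := (f (cexp z) - f 0) * cexp (- z).
have uE z : u z = (f (cexp z) - f 0) / cexp z.
  congr (_ * _); apply: (mulIf (cexp_neq0 z)).
  rewrite -cexpD addNr mulVf ?cexp_neq0 //.
  by rewrite /cexp /= expR0 cos0 sin0 mulr1 mulr0.
have du z : exists b, has_cderiv u z b.
  have [b fb] := df (cexp z).
  have dN : has_cderiv (fun t : R[i] => - t) z (-1).
    apply: has_cderiv_near (has_cderiv_affine 0 (-1) z).
    by exists 1 => // h _; ring.
  apply: has_cderivM (has_cderiv_comp dN (has_cderiv_cexp _)).
  exact: has_cderivD (has_cderiv_comp (has_cderiv_cexp z) fb) (has_cderiv_cst _ _).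
have uP z : u (z + (pi *+ 2)*i) = u z by rewrite !uE cexp_2pi.
have P0 : 0 < pi *+ 2 :> R by rewrite mulrn_wgt0 // pi_gt0.
apply/ler_addgt0Pr => e e0.
have [q q0 fq] := fd (e / 2) (divr_gt0 e0 (ltr0Sn _ _)).
(* The abscissae [t] and [s] stand for the circles of radius [r] and of a radius at most [q / 2],
   where the quotient is within [e / 2] of [d]. [A] lies to the left of [s] and below the height 0,
   where the sides start. *)
pose t := ln r; pose s := Num.min (ln r) (ln (q / 2)).
pose A := Num.min s 0 - 1.
have As : A < s by rewrite /A ltrBlDr gt_min ltrDl ltr01.
have A0 : A < 0 by rewrite /A ltrBlDr gt_min add0r ltr01 orbT.
have st : s <= t by rewrite ge_min lexx.
have := vline_periodic du uP (ltW P0) As st A0.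
have cexpE x y : cabs (cexp (x%:C + 'i * y%:C)) = expR x :> R.
  by rewrite cabs_cexp /= mul0r mul1r subrr addr0.
have Ht : cabs (vline u A t (pi *+ 2) - vline u A t 0 -
    ((0 * (pi *+ 2)%:C + 0 * (pi *+ 2)%:C ^+ 2 / 2) - (0 * 0%:C + 0 * 0%:C ^+ 2 / 2)))
    <= 2 * (M / r) * (pi *+ 2 - 0).
  apply: (primitive_estimate A0 (ltW P0) (vlineP du _)
    (is_primitive_affine 0 0)) => y _.
  rewrite mul0r !addr0 subr0 uE cabsM cabsV cexpE lnK ?posrE //.
  by rewrite ler_pM2r ?invr_gt0 // fM // cexpE lnK.
have Hs : cabs (vline u A s (pi *+ 2) - vline u A s 0 -
    ((d * (pi *+ 2)%:C + 0 * (pi *+ 2)%:C ^+ 2 / 2) - (d * 0%:C + 0 * 0%:C ^+ 2 / 2)))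
    <= 2 * (e / 2) * (pi *+ 2 - 0).
  apply: (primitive_estimate A0 (ltW P0) (vlineP du _)
    (is_primitive_affine d 0)) => y _.
  rewrite mul0r !addr0 uE; set w := cexp _.
  have w0 : w != 0 by exact: cexp_neq0.
  have wq : cabs w < q.
    rewrite cexpE; have : s <= ln (q / 2) by rewrite ge_min lexx orbT.
    rewrite -ler_expR lnK ?posrE ?divr_gt0 //; lra.
  have := fq _ wq; rewrite add0r => H.
  rewrite -(ler_pM2r (_ : 0 < cabs w)) ?cabs_gt0 // -cabsM.
  by rewrite mulrBl divfK.
(* Both estimates concern the same integral by [E]: it is small by [Ht] and close to [d] times 2 pi
   by [Hs]. *)
move: Ht Hs; rewrite !mul0r !addr0 !mulr0 !subr0 => Ht + E; rewrite -E => Hs.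
have : cabs (d * (pi *+ 2)%:C) <= 2 * (M / r) * (pi *+ 2) + 2 * (e / 2) * (pi *+ 2).
  apply: le_trans (lerD Ht Hs); rewrite [X in _ <= _ + X]cabsB.
  by apply: le_trans (cabsD _ _); rewrite addrC subrK.
rewrite cabsM cabs_real (ger0_norm (ltW P0)) => H.
rewrite -(ler_pM2r P0); apply: le_trans H _.
by rewrite [X in _ + X * _]mulrC divfK // -mulrDl.
Qed.

End CauchyEstimate.

(** * Escaping orbits and perturbation *)

Section HenonMap.
Variables (R : realType) (delta : R[i]).
Implicit Types (f : R[i] -> R[i]) (p c v : R[i] * R[i]).

Definition henon_map f p : R[i] * R[i] := (f p.1 - delta * p.2, p.1).

(* Derivative along v at the parameter t of t |-> henon_map^n (c + t v). *)
Fixpoint orbit_deriv f c v n (t : R[i]) : R[i] * R[i] :=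
  if n is m.+1 then
    let w := orbit_deriv f c v m t in
    ('D_1 f (iter m (henon_map f) (c.1 + v.1 * t, c.2 + v.2 * t)).1 * w.1
       - delta * w.2, w.1)
  else v.

Lemma has_cderiv_orbit f c v n (t : R[i]) : entire f ->
  has_cderiv (fun t => (iter n (henon_map f) (c.1 + v.1 * t, c.2 + v.2 * t)).1)
    t (orbit_deriv f c v n t).1 /\
  has_cderiv (fun t => (iter n (henon_map f) (c.1 + v.1 * t, c.2 + v.2 * t)).2)
    t (orbit_deriv f c v n t).2.
Proof.
move=> ef; elim: n => [|n [IH1 IH2]]; first by split; exact: has_cderiv_affine.
split=> //=; apply: has_cderivD.
  exact: has_cderiv_comp IH1 (derivable_has_cderiv (ef _)).
rewrite -mulNr; have := has_cderiv_comp IH2 (has_cderiv_affine 0 (- delta) _).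
by apply: has_cderiv_near; exists 1 => // h _ /=; rewrite add0r mulNr.
Qed.

(* The Jacobian determinant of the n-th iterate is delta ^ n. *)
Lemma orbit_deriv_det f c n :
  (orbit_deriv f c (1, 0) n 0).1 * (orbit_deriv f c (0, 1) n 0).2
  - (orbit_deriv f c (0, 1) n 0).1 * (orbit_deriv f c (1, 0) n 0).2 = delta ^+ n.
Proof.
elim: n => [|n IH] /=; first by rewrite mulr1 mulr0 subr0.
by rewrite exprS -IH !mulr0; ring.
Qed.

(* Bounded orbits on a ball would bound the derivatives at its center, by
   Cauchy's estimate, whereas the Jacobian determinants are unbounded. *)
Lemma orbit_escape f c (r M : R) : 1 < cabs delta -> entire f -> 0 < r ->
  exists p n, [/\ cabs (p.1 - c.1) < r, cabs (p.2 - c.2) < r &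
    M < cabs (iter n (henon_map f) p).1].
Proof.
move=> d1 ef r0; apply: contrapT => nH.
have H p n : cabs (p.1 - c.1) < r -> cabs (p.2 - c.2) < r ->
    cabs (iter n (henon_map f) p).1 <= M.
  by move=> p1 p2; rewrite leNgt; apply/negP => Mp; apply: nH; exists p, n.
have M0 : 0 <= M.
  by apply: le_trans (H c 0%N _ _); rewrite ?cabs_ge0 // subrr cabs0.
(* Cauchy's estimate on the parameter circle of radius [r / 2], where the values differ from the
   central one by at most [M + M]. *)
pose K := 2 * ((M + M) / (r / 2)).
have K0 : 0 <= K.
  by rewrite mulr_ge0 ?ler0n // divr_ge0 ?addr_ge0 // divr_ge0 ?ler0n // ltW.
have DK v n : cabs v.1 <= 1 -> cabs v.2 <= 1 ->
    cabs (orbit_deriv f c v n 0).1 <= K.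
  move=> v1 v2; have r2 : 0 < r / 2 by rewrite divr_gt0.
  apply: (cauchy_estimate _ (has_cderiv_orbit c v n 0 ef).1 r2).
    by move=> t; exists (orbit_deriv f c v n t).1; exact: (has_cderiv_orbit c v n t ef).1.
  move=> t tr; apply: le_trans (cabsD _ _) _; rewrite cabsN.
  have cv (x w : R[i]) : cabs w <= 1 -> cabs (x + w * t - x) < r.
    move=> w1; rewrite addrAC subrr add0r cabsM tr.
    have := ler_wpM2r (ltW r2) w1; lra.
  by apply: lerD; apply: H => /=; rewrite ?mulr0 ?addr0 ?subrr ?cabs0 //; exact: cv.
have e1 n : cabs (orbit_deriv f c (1, 0) n 0).1 <= K.
  by apply: DK => /=; rewrite ?cabs1 ?cabs0.
have e2 n : cabs (orbit_deriv f c (0, 1) n 0).1 <= K.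
  by apply: DK => /=; rewrite ?cabs1 ?cabs0.
(* Only first components were bounded; at time [n.+1] the second components are the first ones at
   time [n]. *)
have dn n : cabs delta ^+ n.+1 <= 2 * (K * K).
  rewrite -cabsX -(orbit_deriv_det f c); apply: le_trans (cabsD _ _) _.
  rewrite cabsN !cabsM mulr2n mulrDl mul1r.
  have e1' := e1 n; have e2' := e2 n.
  by apply: lerD; apply: ler_pM; rewrite ?cabs_ge0 // ?e1 ?e2.
have d0 : 0 < cabs delta by apply: lt_trans d1.
have [|N /(_ N.+1 (leqnSn _))] :=
    @geometric_small _ (2 * (K * K)) (cabs delta)^-1 1 _ ltr01.
  by rewrite ger0_norm ?invr_ge0 ?cabs_ge0 // invf_lt1.
by rewrite exprVn ltr_pdivrMr ?exprn_gt0 // mul1r ltNge dn.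
Qed.

End HenonMap.

Section Perturbation.
Variables (R : realType) (delta : R[i]).
Hypothesis delta1 : 1 < cabs delta.
Implicit Types (f g : R[i] -> R[i]) (p q c : R[i] * R[i]).
Local Notation henon_map := (henon_map delta).

Definition near_pair p q (r : R) := cabs (p.1 - q.1) < r /\ cabs (p.2 - q.2) < r.

(* In the projective plane, [u.1 : u.2 : 1] is then away from [1 : 0 : 0], and
   [v.1 : v.2 : 1] is close to it. *)
Definition separated (u v : R[i] * R[i]) :=
  [/\ cabs u.1 < cabs u.2, 1 < cabs u.2 & 10 * (cabs v.2 + 1) < cabs v.1].

Definition henon_inv f p : R[i] * R[i] := (p.2, (f p.2 - p.1) / delta).

Let delta0 : delta != 0.
Proof. by rewrite -cabs_gt0; exact: lt_trans delta1. Qed.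

Lemma henon_invK f : cancel (henon_inv f) (henon_map f).
Proof.
by case=> x y; rewrite /henon_map /henon_inv /= mulrC divfK // subKr.
Qed.

Lemma henon_mapK f : cancel (henon_map f) (henon_inv f).
Proof.
by case=> x y; rewrite /henon_map /henon_inv /= subKr mulrC mulKf.
Qed.

(** A backward step evaluates [f] at the second coordinate only, so [g] has to be close to [f]
    merely on a disc containing the second coordinates along the orbit. *)
Lemma henon_inv_perturb f p n (k s : R) : entire f -> 0 < s ->
  (forall j, (j < n)%N -> cabs (iter j (henon_inv f) p).2 < k) ->
  exists2 e : R, 0 < e & forall q g, near_pair q p e ->
    (forall z, cabs z < k -> cabs (g z - f z) < e) ->
    near_pair (iter n (henon_inv g) q) (iter n (henon_inv f) p) s.
Proof.
move=> ef; elim: n s => [|n IH] s s0 pk; first by exists s.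
set x := iter n (henon_inv f) p in IH *.
have xk : cabs x.2 < k by exact: pk.
(* Three errors of size [s / 3] meet in the new second coordinate: [g - f], the variation of [f],
   and the error of the old first coordinate. Dividing by [delta] shrinks their sum. The bound
   [t <= k - cabs x.2] keeps the perturbed point in the disc. *)
have s3 : 0 < s / 3 by rewrite divr_gt0.
have [d fd] := entire_has_cderiv ef x.2.
have [r r0 fr] := has_cderiv_cont fd s3.
have [t [t0 ts tr tk]] :
    exists t, [/\ 0 < t, t <= s / 3, t <= r & t <= k - cabs x.2].
  exists (Num.min (s / 3) (Num.min r (k - cabs x.2))); split.
  - by rewrite !lt_min s3 r0 subr_gt0.
  - by rewrite !ge_min lexx.
  - by rewrite !ge_min lexx orbT.
  - by rewrite !ge_min lexx !orbT.
have [|e e0 H] := IH t t0; first by move=> j jn; apply: pk; exact: ltnW.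
exists (Num.min e (s / 3)); first by rewrite lt_min e0.
move=> q g [qp1 qp2] gf; move: qp1 qp2; rewrite !lt_min => /andP[qp1 _] /andP[qp2 _].
have gf1 z : cabs z < k -> cabs (g z - f z) < e.
  by move=> /gf; rewrite lt_min => /andP[].
have gf2 z : cabs z < k -> cabs (g z - f z) < s / 3.
  by move=> /gf; rewrite lt_min => /andP[].
have [] := H q g (conj qp1 qp2) gf1.
rewrite /= -/x; set y := iter n (henon_inv g) q => xy1 xy2.
split => /=; first by apply: lt_le_trans xy2 _; move: ts s3; lra.
have yk : cabs y.2 < k.
  by have := cabs_sub_ge y.2 x.2; move: xy2 tk; lra.
have := fr (y.2 - x.2) (lt_le_trans xy2 tr); rewrite subrKC => fyx.
have := gf2 _ yk => gfy.
rewrite -mulrBl cabsM cabsV ltr_pdivrMr; last by apply: lt_trans delta1.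
have -> : g y.2 - y.1 - (f x.2 - x.1) =
  ((g y.2 - f y.2) + (f y.2 - f x.2)) - (y.1 - x.1) by ring.
apply: le_lt_trans (cabsD _ _) _; rewrite cabsN.
apply: le_lt_trans (lerD (cabsD _ _) (lexx _)) _.
apply: (@lt_trans _ _ s); last by rewrite ltr_pMr.
by move: xy1 ts; lra.
Qed.

Lemma iter_cancel (T : Type) (h h' : T -> T) n : cancel h h' ->
  cancel (iter n h) (iter n h').
Proof. by move=> hK; elim: n => // n IH x; rewrite iterSr hK IH. Qed.

Lemma first_escape f c (r M : R) : entire f -> 0 < r ->
  exists p n, [/\ near_pair p c r, M < cabs (iter n (henon_map f) p).1 &
    forall j, (j < n)%N -> cabs (iter j (henon_map f) p).1 <= M].
Proof.
move=> ef r0; have [p [n [p1 p2 pM]]] := orbit_escape c M delta1 ef r0.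
have H : exists n, M < cabs (iter n (henon_map f) p).1 by exists n.
exists p, (ex_minn H); case: ex_minnP => m mM mmin; split => // j jm.
by rewrite leNgt; apply/negP => /mmin; rewrite leqNgt jm.
Qed.

(* When the backward orbit of (x, w) avoids a neighbourhood of the circle of
   radius |x|, adding A (z / x)^N to f hardly changes it, and the image of
   (x, w) becomes (f x + A - delta w, x), while A (y / x)^N is huge if |y| > |x|. *)
Lemma separating_perturbation f c (r rho e : R) : entire f -> 0 < r ->
  1 <= rho -> 0 < e -> exists a N, cabs a * rho ^+ N <= e /\
  exists n p q, [/\ near_pair p c r, near_pair q c r &
    separated (iter n (henon_map (fun z => f z + a * z ^+ N)) p)
              (iter n (henon_map (fun z => f z + a * z ^+ N)) q)].
Proof.
move=> ef r0 rho1 e0.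
have [p [n [[p1 p2] pn pj]]] := first_escape c rho ef r0.
set x := (iter n (henon_map f) p).1 in pn.
set w := (iter n (henon_map f) p).2.
have xw : iter n (henon_map f) p = (x, w) by rewrite /x /w -surjective_pairing.
have x1 : 1 < cabs x by exact: le_lt_trans pn.
have x0 : 0 < cabs x by exact: lt_trans x1.
(* The margin between [rho] and [k] lets the backward orbit move, and the one between [k] and [|x|]
   makes [(z / x) ^+ N] small on the disc of radius [k]. *)
have [k [kn kx]] : exists k, rho < k /\ k < cabs x.
  by exists ((rho + cabs x) / 2); split; lra.
have back : iter n (henon_inv f) (x, w) = p.
  by rewrite -xw (iter_cancel _ (henon_mapK f)).
(* Second coordinates lag by one step: those met here are first coordinates at times before [n],
   hence at most [rho] in modulus. *)
have bk j : (j < n)%N -> cabs (iter j (henon_inv f) (x, w)).2 < k.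
  move=> jn; rewrite -xw -(subnKC (ltnW jn)) iterD (iter_cancel _ (henon_mapK f)).
  rewrite -(subnSK jn) /=; apply: le_lt_trans (pj _ _) kn.
  by rewrite ltn_subrL (leq_ltn_trans _ jn).
have [s [s0 s1 s2]] :
    exists s, [/\ 0 < s, s <= r - cabs (p.1 - c.1) & s <= r - cabs (p.2 - c.2)].
  exists (Num.min (r - cabs (p.1 - c.1)) (r - cabs (p.2 - c.2))); split.
  - by rewrite lt_min !subr_gt0 p1.
  - by rewrite ge_min lexx.
  - by rewrite ge_min lexx orbT.
have [d d0] := henon_inv_perturb ef s0 bk; rewrite back => H.
have {}H y g : near_pair y (x, w) d ->
    (forall z, cabs z < k -> cabs (g z - f z) < d) ->
    near_pair (iter n (henon_inv g) y) c r.
  move=> yx gf; have [H1 H2] := H _ _ yx gf.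
  split; [apply: le_lt_trans (cabs_triangle p.1 _ _) _|
          apply: le_lt_trans (cabs_triangle p.2 _ _) _]; lra.
(* The prescribed next value is 0, or 1 if the value is 0 already, so that [A] is never 0. Either
   way [|tau| <= 1 < |x|]. *)
pose tau : R[i] := (f x - delta * w == 0)%:R.
pose A := tau - (f x - delta * w).
have A0 : A != 0.
  rewrite /A /tau; have [E|E] := eqVneq (f x - delta * w) 0.
    by rewrite E subr0 oner_eq0.
  by rewrite sub0r oppr_eq0.
have tau1 : cabs tau <= 1 by rewrite /tau; case: eqP => _; rewrite ?cabs1 ?cabs0.
(* With this [l] the point [y] lies at distance [d / 2] from [x], on a larger circle. *)
pose l := d / (cabs x + cabs x).
have l0 : 0 < l by rewrite divr_gt0 ?addr_gt0.
have l1 : 0 < 1 + l by rewrite addr_gt0.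
pose y := x * (1 + l)%:C.
have yE : cabs y = cabs x * (1 + l) by rewrite cabsM cabs_real gtr0_norm.
have Acirc v : 0 <= v -> v < cabs x -> forall b : R, 0 < b ->
    exists N, forall m, (N <= m)%N -> cabs A * (v / cabs x) ^+ m < b.
  move=> v0 vx b b0; apply: geometric_small => //.
  by rewrite ger0_norm ?divr_ge0 ?cabs_ge0 // ltr_pdivrMr // mul1r.
have rho0 : 0 <= rho by apply: le_trans rho1.
have [N1 N1P] := Acirc rho rho0 pn e e0.
have [N2 N2P] := Acirc k (le_trans rho0 (ltW kn)) kx d d0.
have cA0 : 0 < cabs A by rewrite cabs_gt0.
have il1 : `|(1 + l)^-1| < 1 by rewrite gtr0_norm ?invr_gt0 // invf_lt1 // ltrDl.
have [N3 N3P] := geometric_small (10 * (cabs y + 1) + cabs (f y - delta * w)) il1 cA0.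
(* [N1] makes the monomial small on [|z| <= rho], [N2] on [|z| < k], and [N3] makes it large enough
   at [y] for [separated]. *)
pose N := (N1 + N2 + N3)%N; pose a := A / x ^+ N.
have aE v : a * v ^+ N = A * (v / x) ^+ N by rewrite /a expr_div_n mulrAC mulrA.
have x00 : x != 0 by rewrite -cabs_gt0.
exists a, N; set g := fun z => f z + a * z ^+ N; split.
  have -> : cabs a * rho ^+ N = cabs A * (rho / cabs x) ^+ N.
    by rewrite /a cabsM cabsV cabsX expr_div_n mulrAC mulrA.
  by rewrite ltW // N1P // /N -addnA leq_addr.
have gf z : cabs z < k -> cabs (g z - f z) < d.
  move=> zk; rewrite /g addrAC subrr add0r aE cabsM cabsX.
  apply: le_lt_trans (N2P N _); last by rewrite /N addnAC leq_addl.
  rewrite ler_wpM2l ?cabs_ge0 // lerXn2r ?nnegrE ?cabs_ge0 //.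
    by rewrite divr_ge0 ?cabs_ge0 // (le_trans rho0) // ltW.
  by rewrite cabsM cabsV ler_wpM2r ?invr_ge0 ?cabs_ge0 // ltW.
(* The points are pulled back by [g] itself, so [n] forward steps lead exactly to [(x, w)] and
   [(y, w)], and one more separates them. *)
exists n.+1, (iter n (henon_inv g) (x, w)), (iter n (henon_inv g) (y, w)); split.
- by apply: H gf; split; rewrite subrr cabs0.
- apply: H gf; split; rewrite /= ?subrr ?cabs0 //.
  have -> : y - x = x * l%:C by rewrite /y rmorphD rmorph1; ring.
  by rewrite cabsM cabs_real gtr0_norm // /l mulrA ltr_pdivrMr ?addr_gt0 //; nra.
rewrite !iterS !(iter_cancel _ (henon_invK g)) /henon_map /=.
have -> : g x - delta * w = tau by rewrite /g aE divff // expr1n /A; ring.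
split => //; first exact: le_lt_trans x1.
rewrite /g aE /y mulrAC divff // mul1r -/y.
rewrite addrAC; set B := f y - delta * w.
have := N3P N (leq_addl _ _); rewrite -/B exprVn ltr_pdivrMr ?exprn_gt0 //.
have := cabs_sub_ge (A * (1 + l)%:C ^+ N) (- B).
rewrite cabsN opprK cabsM cabsX cabs_real gtr0_norm // [B + _]addrC.
by lra.
Qed.

End Perturbation.

(** * The compact-open topology *)

Section CompactOpen.
Variable R : realType.
Local Notation C := R[i].
Local Notation CC := (C * C)%type.
Let VV : puniformType :=
  HB.pack_for puniformType CC (Uniform.class CC) (Pointed.class CC).
Implicit Types (F G : CC -> CC) (K : set CC) (p q c : CC).

Lemma cabs_continuous : continuous (@cabs R).
Proof.
move=> z A /nbhs_ballP[e /= e0 eA]; apply/nbhs_cabs; exists e => // w wz.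
apply: eA; rewrite /ball /= ltr_norml.
have := cabs_sub_ge z w; have := cabs_sub_ge w z; rewrite (cabsB z w).
by move: wz; lra.
Qed.

Lemma compact_cabs_bounded K : compact K ->
  exists M : R, forall p, K p -> cabs p.1 <= M /\ cabs p.2 <= M.
Proof.
have H (h : CC -> C) : continuous h -> compact K ->
    exists M, forall p, K p -> cabs (h p) <= M.
  move=> ch cK; have cc : continuous (@cabs R \o h).
    by move=> p; apply: continuous_comp; [exact: ch|exact: cabs_continuous].
  have /compact_bounded[M [_ MP]] := continuous_compact (continuous_subspaceT cc) cK.
  exists (M + 1) => p Kp; have := MP (M + 1); rewrite ltrDl => /(_ ltr01 (cabs (h p))).
  by rewrite /= ger0_norm ?cabs_ge0 //; apply; exists p.
move=> cK; have [|M MP] := H fst _ cK; first by move=> p; exact: cvg_fst.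
have [|N NP] := H snd _ cK; first by move=> p; exact: cvg_snd.
exists (Num.max M N) => p Kp; rewrite !le_max MP // NP // orbT.
by [].
Qed.

(** A product of two closed squares of half-side [s]. Their points are within [2 * s] of the centre;
    the factor 3 makes the bound strict. *)
Lemma compact_box c (s : R) : exists K, [/\ compact K,
  forall q, near_pair q c s -> K q & forall q, K q -> 0 < s -> near_pair q c (3 * s)].
Proof.
pose sq (z : C) := (fun xy : R * R => xy.1 +i* xy.2) @`
  (`[Re z - s, Re z + s] `*` `[Im z - s, Im z + s]).
have csq z : compact (sq z).
  apply: continuous_compact; last by apply: compact_setX; exact: segment_compact.
  apply: continuous_subspaceT => -[x y]; apply/cvgrPdist_lt => e e0.
  have er : (Re e)%:C = e by apply: RRe_real; exact: gtr0_real.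
  have e2 : 0 < Re e / 2 by rewrite divr_gt0 // -ltcR er.
  exists (ball x (Re e / 2), ball y (Re e / 2)).
    by split; exact: nbhsx_ballx.
  move=> [a b] /= [xa yb]; rewrite -er -cabsE ltcR.
  apply: le_lt_trans (cabs_le_ReIm _) _ => /=.
  by move: xa yb; rewrite /ball /= => xa yb; lra.
exists (sq c.1 `*` sq c.2); split; first exact: compact_setX.
  have H (z w : C) : cabs (z - w) < s -> sq w z.
    move=> zw; exists (Re z, Im z); last by case: (z).
    have := Re_le_cabs (z - w); have := Im_le_cabs (z - w).
    have -> : Re (z - w) = Re z - Re w by case: (z); case: (w).
    have -> : Im (z - w) = Im z - Im w by case: (z); case: (w).
    rewrite !ler_norml => /andP[? ?] /andP[? ?].
    by split; rewrite /= in_itv /=; apply/andP; split; lra.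
  by move=> [z w] [/H ? /H].
move=> [z w] [/= sz sw] s0.
have H (v u : C) : sq u v -> cabs (v - u) < 3 * s.
  move=> [[a b] [/=]]; rewrite !in_itv /= => /andP[? ?] /andP[? ?] <-.
  apply: le_lt_trans (cabs_le_ReIm _) _ => /=.
  have -> : Re ((a +i* b) - u) = a - Re u by case: (u).
  have -> : Im ((a +i* b) - u) = b - Im u by case: (u).
  have A1 : `|a - Re u| <= s by rewrite ler_norml; apply/andP; split; lra.
  have A2 : `|b - Im u| <= s by rewrite ler_norml; apply/andP; split; lra.
  by lra.
by split; exact: H.
Qed.

Lemma near_pair_ball p q (e : R) : near_pair q p e <-> ball p e%:C q.
Proof.
have H (x y : C) : (cabs (y - x) < e) = (`|x - y| < e%:C).
  by rewrite -cabsE ltcR cabsB.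
by rewrite /near_pair !H.
Qed.

Lemma entourage_near_pair (E : set (CC * CC)) : entourage E <->
  exists2 e : R, 0 < e & [set pq | near_pair pq.2 pq.1 e] `<=` E.
Proof.
rewrite -entourage_ballE; split=> [[e /= e0 eE]|[e e0 eE]].
  have er : (Re e)%:C = e by apply: RRe_real; exact: gtr0_real.
  exists (Re e); first by rewrite -ltcR er.
  by move=> [p q] /near_pair_ball; rewrite er => /eE.
exists e%:C; first by rewrite /= ltcR.
by move=> [p q] /near_pair_ball/eE.
Qed.

Definition close_on K F G (e : R) := forall p, K p -> near_pair (G p) (F p) e.

Lemma nbhs_close_on F K (e : R) : continuous F -> compact K -> 0 < e ->
  nbhs (F : {compact-open, CC -> CC}) [set G | close_on K F G e].
Proof.
move=> cF cK e0.
have [+ _] := @compact_open_fam_compactP CC VV F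
  (nbhs (F : {compact-open, CC -> CC})) cF _.
move=> /(_ cvg_id) /fam_cvgP /(_ K cK); apply; apply/uniform_nbhs.
exists [set pq | near_pair pq.2 pq.1 e]; split => //.
by apply/entourage_near_pair; exists e.
Qed.

(** The sets of maps close to [F] on a box generate a filter. It converges to [F] uniformly on
    compact sets, since each lies in a box, hence also in the compact-open topology. *)
Lemma close_on_nbhs F (V : set {compact-open, CC -> CC}) : continuous F ->
  nbhs (F : {compact-open, CC -> CC}) V -> exists M e : R, 0 < e /\
    forall G, close_on [set p | cabs p.1 <= M /\ cabs p.2 <= M] F G e -> V G.
Proof.
move=> cF FV; pose box (M : R) := [set p : CC | cabs p.1 <= M /\ cabs p.2 <= M].
pose FF := filter_from [set Me : R * R | 0 < Me.2]
  (fun Me => [set G | close_on (box Me.1) F G Me.2]).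
have FFF : Filter FF.
  apply: filter_from_filter; first by exists (0, 1) => /=.
  move=> [M e] [N d] /= e0 d0; exists (Num.max M N, Num.min e d).
    by rewrite /= lt_min e0.
  move=> G /= H; split=> p [p1 p2].
    have [|] := H p; first by rewrite /box /= !le_max p1 p2.
    by rewrite !lt_min => /andP[? _] /andP[? _].
  have [|] := H p; first by rewrite /box /= !le_max p1 p2 !orbT.
  by rewrite !lt_min => /andP[_ ?] /andP[_ ?].
have : {compact-open, FF --> F}.
  apply/(@compact_open_fam_compactP CC VV F FF cF FFF).
  apply/fam_cvgP => K cK P.
  move=> /uniform_nbhs[E [/entourage_near_pair[e e0 eE] EP]].
  have [M MP] := compact_cabs_bounded cK.
  exists (M, e) => // G /= GF; apply: EP => p Kp; apply: eE => /=.
  by apply: GF; exact: MP.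
by move=> /(_ V FV)[[M e] /= e0 MeV]; exists M, e.
Qed.

End CompactOpen.

(** * Failure of normality *)

Section Chordal3.
Variable R : realType.
Local Notation C := R[i].
Implicit Types (u v w : 'rV[C]_3).

Lemma dotmx_sum u v : dotmx u v = \sum_i u 0 i * (v 0 i)^*%R.
Proof. by rewrite dotmxE mxE; apply: eq_bigr => i _; rewrite !mxE. Qed.

Lemma sqr_chordal u v : u != 0 -> v != 0 ->
  chordal u v ^+ 2 = 1 - `|dotmx u v| ^+ 2 / (dotmx u u * dotmx v v).
Proof. by rewrite /chordal sqrtCK. Qed.

Lemma dotmx_self u : dotmx u u = (\sum_i cabs (u 0 i) ^+ 2)%:C.
Proof.
rewrite dotmx_sum rmorph_sum; apply: eq_bigr => i _.
by rewrite -normCK rmorphXn /= cabsE.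
Qed.

(* Here a = |u|^2, b = <u, w>, d = |w|^2 and c = |u + w|^2: the quantity
   |u|^2 |v|^2 - |<u, v>|^2 only depends on v modulo u. *)
Lemma gram_bound (K : numClosedFieldType) (a b c d : K) : 0 < a -> 1 <= c ->
  0 <= d -> c = a + b + (b^* + d)%R -> 1 - `|a + b| ^+ 2 / (a * c) <= d.
Proof.
move=> a0 c1 d0 cE; have c0 : 0 < c by apply: lt_le_trans c1.
have aJ : a^*%R = a by apply: conj_Creal; exact: gtr0_real.
have E : a * c - `|a + b| ^+ 2 = a * d - `|b| ^+ 2.
  by rewrite !normCK rmorphD /= aJ cE; ring.
have ac0 : a * c != 0 by rewrite mulf_neq0 ?gt_eqF.
rewrite -{1}(divff ac0) -mulrBl E ler_pdivrMr ?mulr_gt0 //.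
apply: le_trans (_ : a * d <= _); first by rewrite gerBl exprn_ge0.
by rewrite mulrC ler_wpM2l // ler_peMr // ltW.
Qed.

(** By [gram_bound] the sine is at most the norm of [v - u] as soon as [v] has norm at least 1. *)
Lemma chordal_close u v (t : R) : 1 <= \sum_i cabs (v 0 i) ^+ 2 -> u != 0 ->
  v != 0 -> (forall i, cabs (v 0 i - u 0 i) <= t) ->
  chordal u v ^+ 2 <= (3 * t ^+ 2)%:C.
Proof.
move=> v1 u0 v0 uvt; rewrite sqr_chordal //.
have [w [wE vE]] : exists w, w = v - u /\ v = u + w.
  by exists (v - u); rewrite subrKC.
have dDl (x y z : 'rV[C]_3) : dotmx (x + y) z = dotmx x z + dotmx y z.
  by rewrite !dotmx_sum -big_split; apply: eq_bigr => i _; rewrite !mxE mulrDl.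
have dDr (x y z : 'rV[C]_3) : dotmx z (x + y) = dotmx z x + dotmx z y.
  by rewrite !dotmx_sum -big_split; apply: eq_bigr => i _; rewrite !mxE rmorphD mulrDr.
have wu : dotmx w u = (dotmx u w)^*%R.
  rewrite !dotmx_sum rmorph_sum; apply: eq_bigr => i _.
  by rewrite rmorphM /= conjCK mulrC.
have uv : dotmx u v = dotmx u u + dotmx u w by rewrite -dDr -vE.
have vv : dotmx v v = dotmx u u + dotmx u w + ((dotmx u w)^*%R + dotmx w w).
  by rewrite -wu -uv -dDr -vE -dDl -vE.
have self0 (x : 'rV[C]_3) : 0 <= dotmx x x.
  by rewrite dotmx_self ler0c; apply: sumr_ge0 => i _; rewrite exprn_ge0 ?cabs_ge0.
have uu0 : 0 < dotmx u u by rewrite lt0r (dnorm_eq0 (@dotmx C 3)) u0 self0.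
have vv1 : 1 <= dotmx v v by rewrite dotmx_self lecR.
rewrite uv; apply: le_trans (gram_bound uu0 vv1 (self0 w) vv) _.
rewrite dotmx_self lecR.
apply: le_trans (_ : \sum_(i < 3) t ^+ 2 <= _).
  apply: ler_sum => i _; rewrite wE !mxE.
  by rewrite lerXn2r ?nnegrE ?cabs_ge0 // (le_trans (cabs_ge0 _) (uvt i)).
by rewrite sumr_const card_ord mulr_natl.
Qed.

(** The squared cosine turns out to be at most 61/100, so the squared sine exceeds 1/4. *)
Lemma chordal_separated (u v : C * C) : separated u v ->
  2^-1 < P2_dist (affine u) (affine v).
Proof.
case: u v => [u1 u2] [v1 v2]; rewrite /separated /= => -[h1 h2 h3].
rewrite /affine P2_dist_pi /=.
set x := affine_vec _; set y := affine_vec _.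
have xx : dotmx x x = (cabs u1 ^+ 2 + cabs u2 ^+ 2 + 1)%:C.
  rewrite dotmx_self !big_ord_recl big_ord0 !mxE /= cabs1 expr1n.
  by rewrite addr0 addrA.
have yy : dotmx y y = (cabs v1 ^+ 2 + cabs v2 ^+ 2 + 1)%:C.
  rewrite dotmx_self !big_ord_recl big_ord0 !mxE /= cabs1 expr1n.
  by rewrite addr0 addrA.
have xy : cabs (dotmx x y) <= cabs u1 * cabs v1 + cabs u2 * cabs v2 + 1.
  rewrite dotmx_sum !big_ord_recl big_ord0 !mxE /= addr0 rmorph1 mulr1 addrA.
  have cJ (z : C) : cabs z^*%R = cabs z by rewrite /cabs norm_conjC.
  apply: le_trans (cabsD _ _) _; rewrite cabs1 lerD2r.
  by apply: le_trans (cabsD _ _) _; rewrite !cabsM !cJ.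
have c0 : 0 <= chordal x y by apply: chordal_ge0; exact: affine_vec_neq0.
rewrite -(ltr_pXn2r (_ : (0 < 2)%N)) ?nnegrE ?invr_ge0 //.
rewrite sqr_chordal ?affine_vec_neq0 // xx yy -cabsE.
have -> : (2^-1 : C) ^+ 2 = (4^-1 : R)%:C.
  by rewrite fmorphV rmorph_nat exprVn -natrX.
set N := cabs u1 ^+ 2 + _ + 1; set M := cabs v1 ^+ 2 + _ + 1.
have -> : 1 - (cabs (dotmx x y))%:C ^+ 2 / (N%:C * M%:C) =
    (1 - cabs (dotmx x y) ^+ 2 / (N * M))%:C.
  by rewrite rmorphB rmorph1 fmorph_div rmorphXn rmorphM.
rewrite ltcR; move: xy h1 h2 h3; rewrite /N /M.
have := cabs_ge0 (dotmx x y); move: (cabs (dotmx x y)) => z.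
have := cabs_ge0 u1; have := cabs_ge0 v2.
move: (cabs u1) (cabs u2) (cabs v1) (cabs v2) => a b c d.
move=> d0 a0 z0 zle ab b1 dc.
(* As [b > 1], one has [b * d + 1 <= b * (d + 1) <= b * c / 10]. *)
have zc : z <= c * (a + b / 10).
  have : b * (10 * (d + 1)) <= b * c by rewrite ler_wpM2l //; lra.
  by lra.
have c1 : 0 < c by lra.
have z2 : z ^+ 2 <= (c * (a + b / 10)) ^+ 2.
  by rewrite lerXn2r ?nnegrE // (le_trans z0).
(* The extreme case is [a = b], with 1.21 against 1.22 times [b ^+ 2]. *)
have ab2 : (a + b / 10) ^+ 2 <= 61 / 100 * (a ^+ 2 + b ^+ 2) by nra.
have abc : z ^+ 2 <= 61 / 100 * (c ^+ 2 * (a ^+ 2 + b ^+ 2)).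
  apply: le_trans z2 _; rewrite exprMn.
  have := ler_wpM2l (sqr_ge0 c) ab2; lra.
have NM : 0 < (a ^+ 2 + b ^+ 2 + 1) * (c ^+ 2 + d ^+ 2 + 1).
  by rewrite mulr_gt0 // ltr_wpDl ?addr_ge0 ?sqr_ge0.
suff : z ^+ 2 / ((a ^+ 2 + b ^+ 2 + 1) * (c ^+ 2 + d ^+ 2 + 1)) <= 61 / 100 by lra.
rewrite ler_pdivrMr //; apply: le_trans abc _.
rewrite ler_wpM2l ?divr_ge0 // mulrC ler_pM ?addr_ge0 ?sqr_ge0 //.
  by rewrite lerDl.
by rewrite -addrA lerDl addr_ge0 ?sqr_ge0.
Qed.

End Chordal3.

Section NonNormality.
Variable R : realType.
Local Notation C := R[i].
Local Notation CC := (C * C)%type.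

Lemma P2_dist_holomorphic (U : set CC) (g : CC -> P2 R) (c : CC) (e : R) :
  holomorphic_on U g -> U c -> 0 < e ->
  exists2 r : R, 0 < r & forall p, near_pair p c r -> P2_dist (g c) (g p) < e%:C.
Proof.
move=> gU /gU[i [gi dg]] e0.
have e2 : 0 < e / 2 by rewrite divr_gt0.
have H j : exists2 r : R, 0 < r & forall p, near_pair p c r ->
    cabs (hratio j i (g p) - hratio j i (g c)) < e / 2.
  have /differentiable_continuous cj := dg j.
  have : nbhs (hratio j i (g c)) [set z | cabs (z - hratio j i (g c)) < e / 2].
    by apply/nbhs_cabs; exists (e / 2).
  move=> /cj /nbhs_cabs2[r r0 rP]; exists r => // p [p1 p2].
  exact: rP.
have [r r0 rP] : exists2 r : R, 0 < r & forall p, near_pair p c r ->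
    forall j, cabs (hratio j i (g p) - hratio j i (g c)) < e / 2.
  have /choice[f fP] : forall j, exists r : R, 0 < r /\ forall p, near_pair p c r ->
      cabs (hratio j i (g p) - hratio j i (g c)) < e / 2.
    by move=> j; have [r ? ?] := H j; exists r.
  exists (\big[Num.min/1]_j f j).
    by apply: lt_bigmin => // j _; have [] := fP j.
  move=> p [p1 p2] j; have [_] := fP j; apply; split.
    by apply: lt_le_trans p1 _; exact: bigmin_le.
  by apply: lt_le_trans p2 _; exact: bigmin_le.
have [s s0 sP] := (nbhs_cabs2 _ _).1 gi.
have gc : chart_dom i (g c) by apply: sP; rewrite subrr cabs0.
exists (Num.min r s); first by rewrite lt_min r0.
move=> p [p1 p2]; move: p1 p2; rewrite !lt_min => /andP[p1 p3] /andP[p2 p4].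
have gp : chart_dom i (g p) by exact: sP.
have {}rP := rP p (conj p1 p2).
rewrite /P2_dist.
(* Rescaled representatives have the chart ratios as coordinates and i-th coordinate 1, hence norm
   at least 1 as [chordal_close] requires. *)
rewrite -(@chordalZ _ _ (hcoords (g c) 0 i)^-1 (hcoords (g p) 0 i)^-1) ?invr_eq0 //.
set u := _ *: _; set v := _ *: _.
have uE j : u 0 j = hratio j i (g c) by rewrite mxE mulrC.
have vE j : v 0 j = hratio j i (g p) by rewrite mxE mulrC.
have u0 : u != 0 by rewrite scaler_eq0 negb_or invr_eq0 gc hcoords_neq0.
have v0 : v != 0 by rewrite scaler_eq0 negb_or invr_eq0 gp hcoords_neq0.
have e0' : 0 <= e%:C by rewrite ler0c ltW.
rewrite -(ltr_pXn2r (_ : (0 < 2)%N)) ?nnegrE ?chordal_ge0 //.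
apply: le_lt_trans (@chordal_close _ u v (e / 2) _ u0 v0 _) _.
- rewrite (bigD1 i) //= vE /hratio divff // cabs1 expr1n lerDl.
  by apply: sumr_ge0 => j _; rewrite exprn_ge0 ?cabs_ge0.
- by move=> j; rewrite uE vE ltW.
rewrite -rmorphXn ltcR; have : 0 < e ^+ 2 by rewrite exprn_gt0.
by rewrite expr_div_n; lra.
Qed.

Lemma P2_dist_sym (x y : P2 R) : P2_dist x y = P2_dist y x.
Proof. exact: chordalC. Qed.

Lemma P2_dist_trans (y x z : P2 R) : P2_dist x z <= P2_dist x y + P2_dist y z.
Proof. by apply: chordal_triangle; exact: hcoords_neq0. Qed.

(** Along a convergent subsequence of the separating times, both images come within 1/4 of [g c]:
    1/8 from uniform convergence on a compact neighbourhood, 1/8 from continuity of the limit. Yet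
    separated points are more than 1/2 apart. *)
Lemma separated_not_normal (U : set CC) (F : CC -> CC) (c : CC) : open U -> U c ->
  (forall m : nat, exists n p q, [/\ near_pair p c m.+1%:R^-1,
     near_pair q c m.+1%:R^-1 & separated (iter n F p) (iter n F q)]) ->
  ~ normal_on U (fun n => @affine R \o iter n F).
Proof.
move=> oU Uc sepF nU.
have /choice[k kP] : forall m, exists n, exists p q, [/\ near_pair p c m.+1%:R^-1,
  near_pair q c m.+1%:R^-1 & separated (iter n F p) (iter n F q)] by [].
have [phi [phiS [g gU cvg]]] := nU k.
have [s s0 sU] : exists2 s : R, 0 < s & forall q, near_pair q c s -> U q.
  have : nbhs c U by apply: open_nbhs_nbhs.
  by move=> /nbhs_cabs2[s s0 sP]; exists s => // q [q1 q2]; exact: sP.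
have s3 : 0 < s / 3 by rewrite divr_gt0.
have [K [cK sK Ks]] := compact_box c (s / 3).
have KU : K `<=` U.
  have s33 : 3 * (s / 3) = s by lra.
  by move=> q /Ks/(_ s3); rewrite s33 => /sU.
have e8 : 0 < 8^-1 :> R by rewrite invr_gt0.
have [r r0 rP] := P2_dist_holomorphic gU Uc e8.
have := cvg; rewrite fam_cvgP => /(_ K (conj KU cK)).
set E := [set xy : P2 R * P2 R | P2_dist xy.1 xy.2 < (8^-1)%:C].
have entE : entourage E.
  apply: (@entourage_ball _ (P2 R) (PosNum (_ : 0 < (8^-1)%:C))).
  by rewrite ltcR.
move=> /(_ [set h | forall y, K y -> E (g y, h y)]) [].
  by apply/uniform_nbhs; exists E; split.
move=> N _ NP.
have [m [mN mr ms]] : exists m, [/\ (N <= m)%N, m.+1%:R^-1 < r & m.+1%:R^-1 < s / 3].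
  have rs : 0 < Num.min r (s / 3) by rewrite lt_min r0.
  have [M _ MP] := near_infty_natSinv_lt (PosNum rs).
  exists (maxn N M); split; first exact: leq_maxl.
    by have := MP (maxn N M) (leq_maxr _ _); rewrite /= lt_min => /andP[].
  by have := MP (maxn N M) (leq_maxr _ _); rewrite /= lt_min => /andP[].
(* The pair at hand belongs to the index [phi m], whose ball is no larger than that of [m]. *)
have mphi : (m <= phi m)%N.
  by elim: (m) => // j IH; apply: leq_ltn_trans IH (phiS _ _ (ltnSn j)).
have phim : (phi m).+1%:R^-1 <= m.+1%:R^-1 :> R.
  by rewrite lef_pV2 ?posrE // ler_nat.
have [p [q [pc qc /chordal_separated]]] := kP (phi m).
have nearK x : near_pair x c (phi m).+1%:R^-1 -> near_pair x c r /\ K x.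
  move=> [x1 x2]; split.
    by split; apply: le_lt_trans mr; apply: le_trans phim; exact: ltW.
  by apply: sK; split; apply: le_lt_trans ms; apply: le_trans phim; exact: ltW.
have [pr Kp] := nearK _ pc; have [qr Kq] := nearK _ qc.
have H1 : P2_dist (g p) (affine (iter (k (phi m)) F p)) < (8^-1)%:C := NP m mN p Kp.
have H2 : P2_dist (g q) (affine (iter (k (phi m)) F q)) < (8^-1)%:C := NP m mN q Kq.
have H3 := rP _ pr; have H4 := rP _ qr.
move=> sep; suff : P2_dist (affine (iter (k (phi m)) F p))
    (affine (iter (k (phi m)) F q)) <= 2^-1.
  by move=> /(lt_le_trans sep); rewrite ltxx.
apply: le_trans (P2_dist_trans (g p) _ _) _; rewrite P2_dist_sym.
apply: le_trans (lerD (lexx _) (P2_dist_trans (g c) _ _)) _.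
rewrite [P2_dist (g p) (g c)]P2_dist_sym.
apply: le_trans (lerD (lexx _) (lerD (lexx _) (P2_dist_trans (g q) _ _))) _.
apply: le_trans (lerD (ltW H1) (lerD (ltW H3) (lerD (ltW H4) (ltW H2)))) _.
have -> : (2^-1 : C) = (2^-1 : R)%:C by rewrite fmorphV rmorph_nat.
by rewrite -!rmorphD lecR; lra.
Qed.

End NonNormality.

(** * A Baire argument for entire functions *)

Section EntireBaire.
Variable R : realType.
Local Notation C := R[i].
Implicit Types (f g : C -> C) (z t : C).

(** With increments at most [e k - e k.+1], the intervals of radius [e k] about the real parts are
    nested, and likewise for the imaginary parts; adding both gives the factor 2. *)
Lemma telescoping_limit (s : nat -> C) (e : nat -> R) : (forall k, 0 <= e k) ->
  (forall k, cabs (s k.+1 - s k) <= e k - e k.+1) ->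
  exists l, forall k, cabs (l - s k) <= 2 * e k.
Proof.
move=> e0 se.
have H (h : nat -> R) : (forall k, `|h k.+1 - h k| <= e k - e k.+1) ->
    exists l, forall k, `|l - h k| <= e k.
  move=> he; have [k|k|k|l lP] :=
      @nested_segments _ (fun k => h k - e k) (fun k => h k + e k).
  - by have := he k; rewrite ler_norml => /andP[]; lra.
  - by have := he k; rewrite ler_norml => /andP[]; lra.
  - by have := e0 k; lra.
  exists l => k; have := lP k; rewrite ler_norml => /andP[? ?].
  by apply/andP; split; lra.
have ReB (x y : C) : Re (x - y) = Re x - Re y by case: x; case: y.
have ImB (x y : C) : Im (x - y) = Im x - Im y by case: x; case: y.
have [k|a aP] := H (fun k => Re (s k)).
  by rewrite -ReB; apply: le_trans (Re_le_cabs _) (se k).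
have [k|b bP] := H (fun k => Im (s k)).
  by rewrite -ImB; apply: le_trans (Im_le_cabs _) (se k).
exists (a +i* b) => k; apply: le_trans (cabs_le_ReIm _) _.
by rewrite ReB ImB /=; have := aP k; have := bP k; lra.
Qed.

Lemma entireD_monomial f a (n : nat) : entire f ->
  entire (fun z => f z + a * z ^+ n).
Proof.
move=> ef z; have [d dX] : exists d, has_cderiv (fun w => w ^+ n) z d.
  elim: n => [|n [d dX]]; first by exists 0; exact: has_cderiv_cst.
  have [b bX] := has_cderivM (has_cderiv_affine 0 1 z) dX.
  exists b; apply: has_cderiv_near bX; exists 1 => // h _.
  by rewrite add0r mul1r exprS.
have aX := has_cderivD (derivable_has_cderiv (ef z))
  (has_cderiv_comp dX (has_cderiv_affine 0 a _)).
apply: has_cderiv_derivable (has_cderiv_near _ aX).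
by exists 1 => // h _; rewrite /= add0r.
Qed.

(** The remainders satisfy r_(n+1) = (z + t) r_n + n z^(n-1) t^2, and n^2 + n <= (n+1)^2. *)
Lemma monomial_second_order (n : nat) z t (rho : R) : 1 <= rho ->
  cabs z <= rho -> cabs (z + t) <= rho ->
  cabs ((z + t) ^+ n - z ^+ n - n%:R * z ^+ n.-1 * t)
    <= (n ^ 2)%:R * rho ^+ n * cabs t ^+ 2.
Proof.
move=> rho1 zr ztr; have rho0 : 0 <= rho by apply: le_trans rho1.
elim: n => [|n IH].
  by rewrite !expr0 !mul0r subrr subr0 cabs0.
have -> : (z + t) ^+ n.+1 - z ^+ n.+1 - n.+1%:R * z ^+ n.+1.-1 * t =
    (z + t) * ((z + t) ^+ n - z ^+ n - n%:R * z ^+ n.-1 * t)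
    + n%:R * z ^+ n.-1 * t ^+ 2.
  case: n {IH} => [|n] /=; first by rewrite !expr0 !expr1; ring.
  by rewrite !exprS -!natr1; ring.
apply: le_trans (cabsD _ _) _; rewrite !cabsM !cabsX cabs_nat.
set y := cabs t ^+ 2; have y0 : 0 <= y by rewrite sqr_ge0.
have A1 := ler_pM (cabs_ge0 _) (cabs_ge0 _) ztr IH.
have A2 : n%:R * cabs z ^+ n.-1 * y <= n%:R * rho ^+ n.+1 * y.
  rewrite ler_wpM2r // ler_wpM2l //; apply: le_trans (_ : rho ^+ n.-1 <= _).
    by rewrite lerXn2r ?nnegrE ?cabs_ge0.
  by rewrite ler_weXn2l // (leq_trans (leq_pred n)).
apply: le_trans (lerD A1 A2) _.
have -> : rho * ((n ^ 2)%:R * rho ^+ n * y) = (n ^ 2)%:R * (rho ^+ n.+1 * y).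
  by rewrite exprS; ring.
have X0 : 0 <= rho ^+ n.+1 * y by rewrite mulr_ge0 // exprn_ge0.
rewrite -!mulrA -mulrDl ler_wpM2r // -natrD ler_nat.
by rewrite -(addn1 n) sqrnD muln1 -addnA leq_add2l mul2n -addnn addnA leq_addl.
Qed.

(** Since n and n^2 are at most 4^n, enlarging the radius by the factor 4 yields one bound for
    value, derivative and second-order remainder. *)
Lemma monomial_bounds (n : nat) z t a (rho : R) : 1 <= rho ->
  cabs z <= rho -> cabs (z + t) <= rho ->
  [/\ cabs (a * z ^+ n) <= cabs a * (4 * rho) ^+ n,
      cabs (a * (n%:R * z ^+ n.-1)) <= cabs a * (4 * rho) ^+ n &
      cabs (a * (z + t) ^+ n - a * z ^+ n - a * (n%:R * z ^+ n.-1) * t)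
        <= cabs a * (4 * rho) ^+ n * cabs t ^+ 2].
Proof.
move=> rho1 zr ztr; have rho0 : 0 <= rho by apply: le_trans rho1.
have n2 : ((n ^ 2)%:R : R) <= 4 ^+ n.
  rewrite -natrX ler_nat (_ : 4 = 2 ^ 2)%N // expnAC leq_exp2r //.
  exact: ltnW (ltn_expl _ _).
have n1 : (n%:R : R) <= 4 ^+ n.
  by apply: le_trans n2; rewrite ler_nat; case: (n) => // m; rewrite -mulnn leq_pmulr.
have zn : cabs z ^+ n <= rho ^+ n by rewrite lerXn2r ?nnegrE ?cabs_ge0.
split.
- rewrite cabsM cabsX ler_wpM2l ?cabs_ge0 // exprMn.
  by apply: le_trans zn _; rewrite ler_peMl ?exprn_ge0 // exprn_ege1 // ler1n.
- rewrite !cabsM cabs_nat cabsX ler_wpM2l ?cabs_ge0 // exprMn.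
  rewrite ler_pM ?exprn_ge0 ?cabs_ge0 //; apply: le_trans (_ : rho ^+ n.-1 <= _).
    by rewrite lerXn2r ?nnegrE ?cabs_ge0.
  by rewrite ler_weXn2l // leq_pred.
have -> : a * (z + t) ^+ n - a * z ^+ n - a * (n%:R * z ^+ n.-1) * t =
    a * ((z + t) ^+ n - z ^+ n - n%:R * z ^+ n.-1 * t) by ring.
rewrite cabsM -[X in _ <= X]mulrA ler_wpM2l ?cabs_ge0 // exprMn.
apply: le_trans (monomial_second_order n rho1 zr ztr) _.
by rewrite ler_wpM2r ?sqr_ge0 // ler_wpM2r // exprn_ge0.
Qed.

Definition uclose (rho e : R) f g := forall z, cabs z <= rho -> cabs (g z - f z) <= e.

(* If each P i is "open and dense", it survives in the limit of a series of
   monomials decaying so fast that the limit is again entire. *)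
Lemma entire_baire (P : nat -> (C -> C) -> Prop) :
  (forall i f, entire f -> P i f -> exists rho e : R, 0 < e /\
     forall g, entire g -> uclose rho e f g -> P i g) ->
  (forall i f (rho e : R), entire f -> 1 <= rho -> 0 < e -> exists a n,
     cabs a * rho ^+ n <= e /\ P i (fun z => f z + a * z ^+ n)) ->
  forall f (rho e : R), entire f -> 0 < e ->
  exists g, [/\ entire g, uclose rho e f g & forall i, P i g].
Proof.
move=> Popen Pdense f0 rho0 e0 ef0 e00.
pose good (s : (C -> C) * R * R) := [/\ entire s.1.1, 1 <= s.1.2 & 0 < s.2].
(* A state is a function, a radius and a tolerance. Halving the tolerance makes each change at most
   the old tolerance minus the new one, as [telescoping_limit] asks; the total later change is then
   at most twice the tolerance, which [P i] must withstand. *)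
have step i (s : (C -> C) * R * R) : exists s' : (C -> C) * R * R, good s ->
  [/\ good s', s.1.2 + 1 <= s'.1.2, s'.2 <= s.2 / 2,
    (exists a n, cabs a * (4 * s.1.2) ^+ n <= s.2 / 2 /\
       s'.1.1 = fun z => s.1.1 z + a * z ^+ n) &
    forall g, entire g -> uclose s'.1.2 (2 * s'.2) s'.1.1 g -> P i g].
  case: (pselect (good s)) => [|ngs]; last by exists s.
  case: s => -[f rho] e /= [/= ef rho1 e0'].
  have e2 : 0 < e / 2 by rewrite divr_gt0.
  have rho4 : 1 <= 4 * rho by lra.
  have [a [n [an Pg]]] := Pdense i f _ _ ef rho4 e2.
  set g := fun z => _ in Pg.
  have eg : entire g by exact: entireD_monomial.
  have [rho' [e' [e'0 H]]] := Popen i g eg Pg.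
  exists (g, Num.max (rho + 1) rho', Num.min (e / 2) (e' / 2)) => _.
  split => /=.
  - split => //=; last by rewrite lt_min e2 divr_gt0.
    by rewrite le_max; apply/orP; left; lra.
  - by rewrite le_max lexx.
  - by rewrite ge_min lexx.
  - by exists a, n.
  move=> h eh gh; apply: H => // z zr; apply: le_trans (gh z _) _.
    by rewrite le_max zr orbT.
  have : Num.min (e / 2) (e' / 2) <= e' / 2 by rewrite ge_min lexx orbT.
  by lra.
have /choice[N NP] : forall i, exists Ni : (C -> C) * R * R -> (C -> C) * R * R,
    forall s, good s -> [/\ good (Ni s), s.1.2 + 1 <= (Ni s).1.2,
      (Ni s).2 <= s.2 / 2,
      (exists a n, cabs a * (4 * s.1.2) ^+ n <= s.2 / 2 /\
         (Ni s).1.1 = fun z => s.1.1 z + a * z ^+ n) &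
      forall g, entire g -> uclose (Ni s).1.2 (2 * (Ni s).2) (Ni s).1.1 g -> P i g].
  by move=> i; have [Ni NiP] := choice (step i); exists Ni.
pose S k := nat_rect (fun=> ((C -> C) * R * R)%type)
  (f0, Num.max 1 rho0, e0 / 2) (fun i s => N i s) k.
have gS k : good (S k).
  elim: k => [|k IH]; last by have [] := NP k _ IH.
  by split => //=; rewrite ?divr_gt0 // le_max lexx.
pose f k := (S k).1.1; pose rho k := (S k).1.2; pose e k := (S k).2.
have ef k : entire (f k) by case: (gS k).
have rho1 k : 1 <= rho k by case: (gS k).
have epos k : 0 < e k by case: (gS k).
have rhoS k : rho k + 1 <= rho k.+1 by case: (NP k _ (gS k)).
have eS k : e k.+1 <= e k / 2 by case: (NP k _ (gS k)).
have /choice[a /choice[n fS]] : forall k, exists a n,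
    cabs a * (4 * rho k) ^+ n <= e k / 2 /\ f k.+1 = fun z => f k z + a * z ^+ n.
  by move=> k; case: (NP k _ (gS k)).
have rho_mono k m : (k <= m)%N -> rho k <= rho m.
  elim: m => [|m IH]; first by rewrite leqn0 => /eqP ->.
  rewrite leq_eqVlt => /orP[/eqP -> //|]; rewrite ltnS => /IH H.
  by have := rhoS m; lra.
have bnd k m z t : (k <= m)%N -> cabs z <= rho k -> cabs (z + t) <= rho k ->
  [/\ cabs (a m * z ^+ n m) <= e m - e m.+1,
      cabs (a m * ((n m)%:R * z ^+ (n m).-1)) <= e m - e m.+1 &
      cabs (a m * (z + t) ^+ n m - a m * z ^+ n m
         - a m * ((n m)%:R * z ^+ (n m).-1) * t) <= (e m - e m.+1) * cabs t ^+ 2].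
  move=> km zr ztr; have H := rho_mono _ _ km.
  have [B1 B2 B3] :=
    monomial_bounds (n m) (a m) (rho1 m) (le_trans zr H) (le_trans ztr H).
  have E : cabs (a m) * (4 * rho m) ^+ n m <= e m - e m.+1.
    by have [+ _] := fS m; have := eS m; lra.
  split; [exact: le_trans B1 E|exact: le_trans B2 E|].
  by apply: le_trans B3 _; rewrite ler_wpM2r ?sqr_ge0.
have bnd0 k m z : (k <= m)%N -> cabs z <= rho k ->
    cabs (a m * z ^+ n m) <= e m - e m.+1 /\
    cabs (a m * ((n m)%:R * z ^+ (n m).-1)) <= e m - e m.+1.
  by move=> km zr; have [|? ? _] := bnd k m z 0 km zr; rewrite ?addr0.
(* Only the added monomials are differentiated: the derivative of the limit at [z] will be that of
   [f k] plus [L z - D k z]. *)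
pose D k z := \sum_(j < k) a j * ((n j)%:R * z ^+ (n j).-1).
have DS m z : D m.+1 z = D m z + a m * ((n m)%:R * z ^+ (n m).-1).
  by rewrite /D big_ord_recr.
have rho_unbounded (x : R) : exists k, x <= rho k.
  have H k : k%:R <= rho k.
    elim: k => [|k IH]; first by apply: le_trans (rho1 0%N).
    by rewrite -natr1; have := rhoS k; lra.
  exists (Num.truncn `|x|).+1; apply: le_trans (H _).
  by apply: le_trans (ler_norm _) _; rewrite ltW // truncnS_gt.
have lim (s : nat -> C -> C) :
    (forall k m z, (k <= m)%N -> cabs z <= rho k ->
       cabs (s m.+1 z - s m z) <= e m - e m.+1) ->
    exists l : C -> C, forall z k, cabs z <= rho k -> cabs (l z - s k z) <= 2 * e k.
  move=> sP; suff /choice[l lP] : forall z, exists y, forall k, cabs z <= rho k ->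
    cabs (y - s k z) <= 2 * e k by exists l.
  move=> z.
  (* The bounds at [z] hold from the first stage [k0] whose disc contains [z]. *)
  case: (ex_minnP (rho_unbounded (cabs z))) => k0 zk0 k0min.
  have [k|k|l lP] := @telescoping_limit (fun k => s (k0 + k)%N z) (fun k => e (k0 + k)%N).
  - by rewrite ltW.
  - by rewrite addnS; apply: sP zk0; exact: leq_addr.
  by exists l => k /k0min/subnKC <-; exact: lP.
have [g gP] : exists g : C -> C, forall z k, cabs z <= rho k ->
    cabs (g z - f k z) <= 2 * e k.
  apply: lim => k m z km zr; have [_ ->] := fS m.
  by rewrite addrAC subrr add0r; have [] := bnd0 _ _ _ km zr.
have [L LP] : exists L : C -> C, forall z k, cabs z <= rho k ->
    cabs (L z - D k z) <= 2 * e k.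
  apply: lim => k m z km zr; rewrite DS.
  by rewrite addrAC subrr add0r; have [] := bnd0 _ _ _ km zr.
(* The second-order remainders telescope like the values, giving a quadratic bound independent of
   [m] that survives the limit. *)
have second k m z t : (k <= m)%N -> cabs z <= rho k -> cabs (z + t) <= rho k ->
    cabs ((f m (z + t) - f k (z + t)) - (f m z - f k z) - (D m z - D k z) * t)
      <= (e k - e m) * cabs t ^+ 2.
  move=> km zr ztr; rewrite -(subnKC km); elim: (m - k)%N => [|i IH].
    by rewrite addn0 !subrr mul0r subrr cabs0 mul0r.
  have [_ _ H] := bnd k (k + i)%N z t (leq_addr _ _) zr ztr.
  rewrite addnS; have [_ ->] := fS (k + i)%N; rewrite DS.
  move: IH H; set m' := (k + i)%N => IH H.
  have -> : e k - e m'.+1 = (e k - e m') + (e m' - e m'.+1) by ring.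
  rewrite [X in _ <= X]mulrDl; apply: le_trans (lerD IH H); apply: le_trans (cabsD _ _).
  by rewrite le_eqVlt; apply/orP; left; apply/eqP; congr cabs; ring.
have e_small (x : R) : 0 < x -> exists m0, forall m, (m0 <= m)%N -> e m < x.
  move=> x0; have [|M MP] := geometric_small (e 0%N) (_ : `|2^-1| < 1 :> R) x0.
    by rewrite ger0_norm //; lra.
  exists M => m /MP; apply: le_lt_trans.
  elim: (m) => [|j IH]; first by rewrite expr0 mulr1.
  by rewrite exprS; have := eS j; lra.
have second_lim k z t : cabs z <= rho k -> cabs (z + t) <= rho k ->
    cabs ((g (z + t) - f k (z + t)) - (g z - f k z) - (L z - D k z) * t)
      <= e k * cabs t ^+ 2.
  move=> zr ztr; apply/ler_addgt0Pr => x x0.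
  (* Replacing [g] and [L] by [f m] and [D m] costs [2 * e m] for each of the two values and
     [2 * e m * cabs t] for the linear term. *)
  have t0 : 0 < 2 * (2 + cabs t) by rewrite mulr_gt0 // ltr_wpDr ?cabs_ge0.
  have [m0 m0P] := e_small _ (divr_gt0 x0 t0).
  pose m := maxn m0 k; have := m0P m (leq_maxl _ _); rewrite ltr_pdivlMr // => emx.
  have km : (k <= m)%N by exact: leq_maxr.
  have H := second k m z t km zr ztr.
  have zm := le_trans zr (rho_mono _ _ km); have ztm := le_trans ztr (rho_mono _ _ km).
  have G1 := gP _ _ zm; have G2 := gP _ _ ztm; have G3 := LP _ _ zm.
  have -> : (g (z + t) - f k (z + t)) - (g z - f k z) - (L z - D k z) * t =
    ((f m (z + t) - f k (z + t)) - (f m z - f k z) - (D m z - D k z) * t) +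
    ((g (z + t) - f m (z + t)) - (g z - f m z) - (L z - D m z) * t) by ring.
  apply: le_trans (cabsD _ _) _; apply: lerD.
    apply: le_trans H _; rewrite ler_wpM2r ?sqr_ge0 //.
    by have := epos m; lra.
  apply: le_trans (cabsD _ _) _; rewrite cabsN cabsM.
  apply: le_trans (lerD (cabsD _ _) (lexx _)) _; rewrite cabsN.
  have := ler_wpM2r (cabs_ge0 t) G3; lra.
have eg : entire g.
  move=> z; have [k zk] := rho_unbounded (cabs z + 1).
  have df := derivable_has_cderiv (ef k z); set d := 'D_1 (f k) z in df.
  apply: (@has_cderiv_derivable _ g z (d + (L z - D k z))) => x x0.
  have x2 : 0 < x / 2 by rewrite divr_gt0.
  have [r r0 rP] := df _ x2.
  exists (Num.min 1 (Num.min r (x / 2 / e k))).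
    by rewrite !lt_min ltr01 r0 divr_gt0.
  move=> t; rewrite !lt_min => /and3P[t1 tr]; rewrite ltr_pdivlMr // => tx.
  have zr : cabs z <= rho k by lra.
  have ztr : cabs (z + t) <= rho k by have := cabsD z t; lra.
  have -> : g (z + t) - g z - (d + (L z - D k z)) * t =
    (f k (z + t) - f k z - d * t) +
    ((g (z + t) - f k (z + t)) - (g z - f k z) - (L z - D k z) * t) by ring.
  apply: le_trans (cabsD _ _) _.
  have := second_lim k z t zr ztr; have := rP t tr.
  have : cabs t * (cabs t * e k) <= cabs t * (x / 2).
    by rewrite ler_wpM2l ?cabs_ge0 // ltW.
  rewrite expr2; lra.
exists g; split => //.
- move=> z zr; have := gP z 0%N; rewrite /rho /e /f /= mulrC divfK //.
  by apply; rewrite le_max zr orbT.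
move=> i; have [_ _ _ _] := NP i _ (gS i); apply => // z zr.
exact: (gP z i.+1).
Qed.

End EntireBaire.

(** * The space of Hénon maps and the spread conditions *)

Section HenonSpace.
Variables (R : realType) (delta : R[i]).
Local Notation C := R[i].
Local Notation CC := (C * C)%type.
Local Notation henon_map := (henon_map delta).
Local Notation H := (henon delta).

Lemma henon_map_continuous (f : C -> C) : entire f -> continuous (henon_map f).
Proof.
move=> ef p A /nbhs_cabs2[e e0 eA].
have [r r0 rP] :=
  has_cderiv_cont (derivable_has_cderiv (ef p.1)) (divr_gt0 e0 (ltr0Sn R 1)).
have d1 : 0 < cabs delta + 1 by rewrite ltr_wpDl ?cabs_ge0.
pose s := Num.min r (Num.min e (e / 2 / (cabs delta + 1))).
apply/nbhs_cabs2; exists s; first by rewrite !lt_min r0 e0 !divr_gt0.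
move=> q; rewrite /s !lt_min => /and3P[q1 q2 _] /and3P[_ _ q3].
apply: eA => //=.
have -> : f q.1 - delta * q.2 - (f p.1 - delta * p.2) =
  (f q.1 - f p.1) - delta * (q.2 - p.2) by ring.
apply: le_lt_trans (cabsD _ _) _; rewrite cabsN cabsM.
have := rP _ q1; rewrite subrKC => q4.
move: q3; rewrite ltr_pdivlMr // => q3.
have := ler_wpM2r (cabs_ge0 (q.2 - p.2)) (lexx (cabs delta)).
have := cabs_ge0 (q.2 - p.2); lra.
Qed.

Lemma henonP (F : H) : exists2 f : C -> C, entire f & val F = henon_map f.
Proof. by have /set_mem[f ef FE] := valP F; exists f. Qed.

Lemma henon_of_entire (f : C -> C) : entire f -> exists F : H, val F = henon_map f.
Proof.
move=> ef; have fH : (henon_map f : {compact-open, CC -> CC}) \in H.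
  by apply/mem_set; exists f.
by exists (exist (fun F : {compact-open, CC -> CC} => F \in H) _ fH).
Qed.

(** In the inductive step the n-th iterate under [G] stays in a compact box about that under [F], on
    which [G] is uniformly close to [F]. *)
Lemma near_iter (F : CC -> CC) n (p : CC) (s : R) : continuous F -> 0 < s ->
  nbhs (F : {compact-open, CC -> CC})
    [set G : CC -> CC | near_pair (iter n G p) (iter n F p) s].
Proof.
move=> cF; elim: n s => [|n IH] s s0.
  apply: (@filterS _ _ (nbhs_filter (F : {compact-open, CC -> CC})) setT).
    by move=> G _; split; rewrite subrr cabs0.
  exact: (@filterT _ _ (nbhs_filter (F : {compact-open, CC -> CC}))).
set x := iter n F p; have s2 : 0 < s / 2 by rewrite divr_gt0.
have : nbhs (F x) [set y | near_pair y (F x) (s / 2)].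
  by apply/nbhs_cabs2; exists (s / 2).
move=> /cF /nbhs_cabs2[r r0 rP].
have [K [cK rK _]] := compact_box x r.
apply: (@filterS2 _ _ (nbhs_filter (F : {compact-open, CC -> CC}))
  _ _ _ _ (IH r r0) (nbhs_close_on cF cK s2)) => G /= xr GF.
rewrite -/x in xr; have [y1 y2] := GF _ (rK _ xr).
have [x1 x2] := rP _ xr.1 xr.2.
split; [apply: le_lt_trans (cabs_triangle (F (iter n G p)).1 _ _) _|
        apply: le_lt_trans (cabs_triangle (F (iter n G p)).2 _ _) _]; lra.
Qed.

Lemma separated_open (u v : CC) : separated u v -> exists2 s : R, 0 < s &
  forall u' v', near_pair u' u s -> near_pair v' v s -> separated u' v'.
Proof.
move=> [h1 h2 h3].
(* Two moduli move in the first inequality, hence the half; in the third, [10 * cabs v.2] and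
   [cabs v.1] together move by less than [11 * s]. *)
have [s [s0 s1 s2 s3]] : exists s : R, [/\ 0 < s, s <= (cabs u.2 - cabs u.1) / 2,
    s <= cabs u.2 - 1 & s <= (cabs v.1 - 10 * (cabs v.2 + 1)) / 11].
  exists (Num.min ((cabs u.2 - cabs u.1) / 2)
    (Num.min (cabs u.2 - 1) ((cabs v.1 - 10 * (cabs v.2 + 1)) / 11))); split.
  - by rewrite !lt_min; apply/and3P; split; lra.
  - by rewrite ge_min lexx.
  - by rewrite !ge_min lexx orbT.
  - by rewrite !ge_min lexx !orbT.
exists s => // u' v' [u1 u2] [v1 v2].
have := cabs_sub_ge u'.1 u.1; have := cabs_sub_ge u.2 u'.2.
have := cabs_sub_ge v.1 v'.1; have := cabs_sub_ge v'.2 v.2.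
rewrite (cabsB v.1) (cabsB u.2) => ? ? ? ?.
by split; lra.
Qed.

Definition spreads (c : CC) (r : R) (F : CC -> CC) := exists n p q,
  [/\ near_pair p c r, near_pair q c r & separated (iter n F p) (iter n F q)].

Lemma henon_nbhs (F : H) (V : set {compact-open, CC -> CC}) :
  nbhs (val F : {compact-open, CC -> CC}) V -> nbhs F [set G : H | V (val G)].
Proof. exact: (@initial_continuous H {compact-open, CC -> CC} set_val F V). Qed.

Lemma open_spreads c r : open [set F : H | spreads c r (val F)].
Proof.
rewrite openE => F [n [p [q [pc qc sep]]]].
have [f ef FE] := henonP F.
have cF : continuous (val F) by rewrite FE; exact: henon_map_continuous.
have [s s0 sP] := separated_open sep.
apply: henon_nbhs; apply: filterS2 (near_iter n p cF s0) (near_iter n q cF s0).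
by move=> G Gp Gq; exists n, p, q; split => //; exact: sP.
Qed.

(** Hénon maps with the same [delta] differ only by [g - f] in the first coordinate, so closeness on
    a box reduces to closeness on a disc. *)
Lemma henon_open_uclose (V : set H) (F : H) (f : C -> C) : open V -> V F ->
  entire f -> val F = henon_map f -> exists rho e : R, 0 < e /\
    forall G g, val G = henon_map g -> uclose rho e f g -> V G.
Proof.
move=> [W oW WV] VF ef FE.
have FW : nbhs (val F : {compact-open, CC -> CC}) W.
  by apply: open_nbhs_nbhs; split => //; move: VF; rewrite -WV.
have cF : continuous (val F) by rewrite FE; exact: henon_map_continuous.
have [M [e [e0 MeW]]] := close_on_nbhs cF FW.
exists M, (e / 2); split; first by rewrite divr_gt0.
move=> G g GE fg; rewrite -WV; apply: MeW => p [p1 p2] /=.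
rewrite [set_val _]GE FE; split => /=; last by rewrite subrr cabs0.
have -> : g p.1 - delta * p.2 - (f p.1 - delta * p.2) = g p.1 - f p.1 by ring.
by apply: le_lt_trans (fg _ p1) _; lra.
Qed.

Definition rat_point (x : (rat * rat) * (rat * rat)) : CC :=
  (ratr x.1.1 +i* ratr x.1.2, ratr x.2.1 +i* ratr x.2.2).

Lemma rat_point_dense (U : set CC) : open U -> U !=set0 ->
  exists x, U (rat_point x).
Proof.
move=> oU [p Up]; have : nbhs p U by apply: open_nbhs_nbhs.
move=> /nbhs_cabs2[e e0 eU].
have Q (z : C) : exists x : rat * rat, cabs ((ratr x.1 +i* ratr x.2) - z) < e.
  have I (y : R) : exists x : rat, `|ratr x - y| < e / 2.
    have : y - e / 2 < y + e / 2 by lra.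
    move=> /rat_in_itvoo[x]; rewrite in_itv /= => /andP[? ?].
    by exists x; rewrite ltr_norml; apply/andP; split; lra.
  have [a aP] := I (Re z); have [b bP] := I (Im z); exists (a, b).
  apply: le_lt_trans (cabs_le_ReIm _) _.
  by case: z aP bP => x y /= aP bP; lra.
have [a aP] := Q p.1; have [b bP] := Q p.2.
by exists (a, b); exact: eU.
Qed.

(** Pairs of a rational point and a radius are coded by naturals; an index that codes no pair
    imposes nothing. *)
Definition spread_family (i : nat) (F : CC -> CC) : Prop :=
  if unpickle i is Some (x, m) then spreads (rat_point x) m.+1%:R^-1 F else True.

Lemma open_spread_family i : open [set F : H | spread_family i (val F)].
Proof.
rewrite /spread_family; case: (unpickle i) => [[x m]|]; last exact: openT.
exact: open_spreads.
Qed.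

(** An open set on which the iterates are normal would contain a rational point, where normality
    fails. *)
Lemma spread_family_julia (F : CC -> CC) : (forall i, spread_family i F) ->
  julia F = setT.
Proof.
move=> spF; apply/seteqP; split => // p _ [U [oU Up nU]].
have [x Ux] := rat_point_dense oU (ex_intro _ p Up).
apply: separated_not_normal oU Ux _ nU => m.
by have := spF (pickle (x, m)); rewrite /spread_family pickleK.
Qed.

Lemma dense_spread_family : 1 < cabs delta ->
  dense [set F : H | forall i, spread_family i (val F)].
Proof.
move=> delta1 O [F OF] oO; have [f ef FE] := henonP F.
have [rho [e [e0 OP]]] := henon_open_uclose oO OF ef FE.
have [||g [eg fg gP]] :=
    @entire_baire _ (fun i g => spread_family i (henon_map g)) _ _ f rho e ef e0.
- move=> i g eg sg; have [G GE] := henon_of_entire eg.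
  have sG : [set F : H | spread_family i (val F)] G by move: sg; rewrite -GE.
  have [r [d [d0 dP]]] := henon_open_uclose (open_spread_family i) sG eg GE.
  exists r, d; split => // h eh gh; have [K KE] := henon_of_entire eh.
  by rewrite -KE; exact: dP KE gh.
- move=> i g r d eg r1 d0; rewrite /spread_family.
  case: unpickle => [[x m]|].
    have m0 : 0 < m.+1%:R^-1 :> R by rewrite invr_gt0.
    exact: (separating_perturbation delta1 (rat_point x) eg m0 r1 d0).
  by exists 0, 0%N; rewrite cabs0 mul0r ltW.
have [G GE] := henon_of_entire eg; exists G; split; first exact: OP GE fg.
by move=> i /=; rewrite GE.
Qed.

End HenonSpace.

Unset Implicit Arguments.
Local Close Scope complex_scope.

Theorem mainTheorem7 (R : realType) (delta : R[i]) (hdelta : 1 < `|delta|) :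
  exists U : set (henon delta),
    [/\ Gdelta U, dense U & forall F : henon delta, U F -> julia (val F) = setT].
Proof.
have delta1 : 1 < cabs delta by rewrite -ltcR cabsE.
exists [set F : henon delta | forall i, spread_family i (val F)]; split.
- exists (fun i => [set F : henon delta | spread_family i (val F)]).
    exact: open_spread_family.
  by apply/seteqP; split => F FP i; [move=> _; exact: FP|exact: (FP i I)].
- exact: dense_spread_family.
- by move=> F; exact: spread_family_julia.
Qed.
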